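(* Let $A$ be a semiprimary ring with Jacobson radical $J$. The following assertions are equivalent: (1) The global dimension of $A$ is finite. (2) The Yoneda ring $E=\mathrm{Ext}_A^*(A/J,A/J)$ is generated in finite degrees, and $\mathrm{Ext}_A^n(S,S)=0$ for all simple $A$-modules $S$ and all $n\gg 0$ (i.e. there is an $m>0$ such that $\mathrm{Ext}_A^n(S,S)=0$ for all simple $A$-modules $S$ and all $n\ge m$).
   Context: All rings are associative with unit and ''module'' means left module. A ring $A$ is semiprimary when its Jacobson radical $J=J(A)$ is nilpotent and $A/J$ is a semisimple ring. For such a ring the left global dimension, right global dimension and weak global dimension coincide, so one speaks of the global dimension. The Yoneda ring of $A$ is the graded ring $E=\mathrm{Ext}_A^*(A/J,A/J)=\bigoplus_{n\ge 0}\mathrm{Ext}_A^n(A/J,A/J)$, with multiplication given by the Yoneda product $\mathrm{Ext}_A^m(N,P)\times \mathrm{Ext}_A^n(M,N)\to \mathrm{Ext}_A^{m+n}(M,P)$ (here with $M=N=P=A/J$) and with the obvious grading. A positively graded ring $R=\bigoplus_{n\ge 0}R_n$ is generated in finite degrees when there is an $m\ge 0$ such that the subgroup $R_0\oplus\cdots\oplus R_m$ generates $R$ as a ring, i.e. no proper subring of $R$ contains $R_0\oplus\cdots\oplus R_m$. *)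

(* Defs.v *)
(* Rings are [pzRingType]s (not necessarily commutative, possibly zero);
   [lmodType A] is the type of left A-modules and [submodClosed V] the type of
   submodules of V, so [submodClosed A^o] is the type of left ideals of A. *)
From HB Require Import structures.
From mathcomp Require Import all_boot all_order all_algebra.
From mathcomp Require Import all_classical.

Set Implicit Arguments.
Unset Strict Implicit.
Unset Printing Implicit Defensive.
Import GRing.Theory.
Local Open Scope ring_scope.
Local Open Scope quotient_scope.

Section Modules.
Variable A : pzRingType.

Definition simple_module (V : lmodType A) : Prop :=
  (exists v : V, v <> 0) /\
  forall W : submodClosed V,
    (forall v, v \in W -> v = 0) \/ (forall v, v \in W).

Definition semisimple_module (V : lmodType A) : Prop :=
  forall W : submodClosed V, exists W' : submodClosed V,
    (forall v, v \in W -> v \in W' -> v = 0) /\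
    (forall v, exists w w', [/\ w \in W, w' \in W' & v = w + w']).

Definition projective (P : lmodType A) : Prop :=
  forall (U V : lmodType A) (g : {linear U -> V}) (f : {linear P -> V}),
    (forall v, exists u, g u = v) ->
    exists h : {linear P -> U}, forall x, g (h x) = f x.

End Modules.

Section SubModule.
Variables (A : pzRingType) (V : lmodType A) (W : submodClosed V).

Record submod := Submod { submod_val : V; submod_valP : submod_val \in W }.

HB.instance Definition _ := [isSub for submod_val].
HB.instance Definition _ := [Choice of submod by <:].
HB.instance Definition _ := [SubChoice_isSubLmodule of submod by <:].

End SubModule.

Section QuotientModule.
Variables (A : pzRingType) (V : lmodType A) (W : submodClosed V).

Fact submod_zmod_closed : zmod_closed W.
Proof. by split=> [|x y xW yW]; rewrite ?rpred0 // -scaleN1r rpredD ?rpredZ. Qed.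

Definition zmodClosed_of_submod : zmodClosed V :=
  HB.pack (GRing.SubmodClosed.sort W)
    (GRing.isZmodClosed.Build V (GRing.SubmodClosed.sort W) submod_zmod_closed).

Definition quotmod := Quotient.quot zmodClosed_of_submod.
HB.instance Definition _ := GRing.Zmodule.on quotmod.
HB.instance Definition _ := EqQuotient.on quotmod.

Lemma quotmodE (x y : V) : (x == y %[mod quotmod]) = (x - y \in W).
Proof. by rewrite -Quotient.idealrBE. Qed.

Definition quotmod_scale (a : A) (x : quotmod) : quotmod := \pi_quotmod (a *: repr x).

Lemma quotmod_scaleE a (x : V) : quotmod_scale a (\pi_quotmod x) = \pi_quotmod (a *: x).
Proof.
apply/eqP; rewrite /quotmod_scale quotmodE -scalerBr rpredZ //.
by rewrite -quotmodE reprK.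
Qed.

Lemma quotmod_piD (x y : V) : \pi_quotmod (x + y) = \pi_quotmod x + \pi_quotmod y.
Proof. by rewrite [RHS]piE. Qed.

Fact quotmod_scalerA a b x :
  quotmod_scale a (quotmod_scale b x) = quotmod_scale (a * b) x.
Proof.
elim/quotW: x => x; rewrite (quotmod_scaleE b) (quotmod_scaleE a).
by rewrite quotmod_scaleE scalerA.
Qed.
Fact quotmod_scale1r : left_id 1 quotmod_scale.
Proof. by elim/quotW=> x; rewrite quotmod_scaleE scale1r. Qed.
Fact quotmod_scalerDr : right_distributive quotmod_scale +%R.
Proof.
move=> a; elim/quotW=> x; elim/quotW=> y.
by rewrite -quotmod_piD !quotmod_scaleE scalerDr quotmod_piD.
Qed.
Fact quotmod_scalerDl x : {morph quotmod_scale^~ x : a b / a + b}.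
Proof.
elim/quotW: x => x a b.
by rewrite !quotmod_scaleE scalerDl quotmod_piD.
Qed.

HB.instance Definition _ := GRing.Zmodule_isLmodule.Build A quotmod
  quotmod_scalerA quotmod_scale1r quotmod_scalerDr quotmod_scalerDl.

End QuotientModule.

Section Jacobson.
Variable A : pzRingType.

Definition maximal_left_ideal (I : submodClosed A^o) : Prop :=
  1 \notin I /\
  forall L : submodClosed A^o, {subset I <= L} -> 1 \notin L -> {subset L <= I}.

Definition jacobson : {pred A^o} :=
  fun x => `[< forall I, maximal_left_ideal I -> x \in I >].

Lemma jacobsonP x :
  reflect (forall I, maximal_left_ideal I -> x \in I) (x \in jacobson).
Proof. exact: asboolP. Qed.

Fact jacobson_submod : submod_closed jacobson.
Proof.
split=> [|a x y /jacobsonP xJ /jacobsonP yJ]; apply/jacobsonP => I Imax.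
  exact: rpred0.
by rewrite rpredD ?rpredZ ?xJ ?yJ.
Qed.
HB.instance Definition _ := GRing.isSubmodClosed.Build A A^o jacobson
  (GRing.submod_closed_semi jacobson_submod).

(* Towards the fact that the radical is two-sided: [colon I a] is the left
   ideal (I : a) and [adjoin I a] is I + Aa. *)
Section LeftIdeals.
Variables (I : submodClosed A^o) (a : A^o).

Definition colon : {pred A^o} := fun r => r * a \in I.
Fact colon_submod : submod_closed colon.
Proof.
split=> [|r x y]; rewrite ![_ \in colon]unfold_in /colon ?mul0r ?rpred0 //.
by move=> xI yI; rewrite mulrDl rpredD // -[_ * x * a]mulrA rpredZ.
Qed.
HB.instance Definition _ := GRing.isSubmodClosed.Build A A^o colon
  (GRing.submod_closed_semi colon_submod).

Definition adjoin : {pred A^o} := fun y => `[< exists r : A, y - r * a \in I >].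
Fact adjoin_submod : submod_closed adjoin.
Proof.
split=> [|r x y /asboolP[s sI] /asboolP[t tI]]; apply/asboolP.
  by exists 0; rewrite mul0r subr0 rpred0.
exists (r * s + t); rewrite mulrDl opprD addrACA rpredD //.
by rewrite -[r * s * a]mulrA -scalerBr rpredZ.
Qed.
HB.instance Definition _ := GRing.isSubmodClosed.Build A A^o adjoin
  (GRing.submod_closed_semi adjoin_submod).

End LeftIdeals.

Lemma colon_maximal (I : submodClosed A^o) (a : A^o) :
  maximal_left_ideal I -> a \notin I -> maximal_left_ideal (colon I a).
Proof.
move=> [I1 Imax] aI; split=> [|L IL L1 b bL].
  by rewrite [_ \in colon _ _]unfold_in /colon mul1r.
apply/negPn/negP => baI.
have [/asboolP[r rI]|/Imax ] := boolP (1 \in adjoin I (b * a : A^o)).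
  case/negP: L1; rewrite -[1](subrK (a * r * b)) rpredD //; last first.
    by rewrite -[_ * b]/((a * r : A) *: (b : A^o)) rpredZ.
  apply: IL; rewrite [_ \in colon _ _]unfold_in /colon mulrBl mul1r.
  have := rpredZ (a : A) rI.
  by rewrite /GRing.scale /= mulrBr mulr1 !mulrA.
move=> /(_ _) H; case/negP: baI; apply: H => [x xI|].
  by apply/asboolP; exists 0; rewrite mul0r subr0.
by apply/asboolP; exists 1; rewrite mul1r subrr rpred0.
Qed.

Lemma jacobson_mulr (x a : A^o) : x \in jacobson -> x * a \in jacobson.
Proof.
move=> /jacobsonP xJ; apply/jacobsonP => I Imax.
have [aI|/(colon_maximal Imax)/xJ //] := boolP (a \in I).
exact: (rpredZ (x : A)).
Qed.

(* A/J, both as a left A-module and as a ring. *)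
Definition quoJ := quotmod jacobson.
HB.instance Definition _ := GRing.Lmodule.on quoJ.
HB.instance Definition _ := EqQuotient.on quoJ.

Definition quoJ_one : quoJ := \pi_quoJ (1 : A^o).
Definition quoJ_mul (x y : quoJ) : quoJ :=
  \pi_quoJ (repr x * repr y).

Lemma quoJE (x y : A^o) : (x == y %[mod quoJ]) = (x - y \in jacobson).
Proof. exact: quotmodE. Qed.

Lemma quoJ_mulE (x y : A^o) :
  quoJ_mul (\pi_quoJ x) (\pi_quoJ y) = \pi_quoJ (x * y).
Proof.
apply/eqP; rewrite /quoJ_mul quoJE.
set x' := repr _; set y' := repr _.
have -> : x' * y' - x * y = x' * (y' - y) + (x' - x) * y.
  by rewrite mulrBr mulrBl addrA subrK.
rewrite rpredD //; first by apply: (rpredZ (x' : A)); rewrite -quoJE reprK.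
by rewrite jacobson_mulr // -quoJE reprK.
Qed.

Lemma quoJ_piD (x y : A^o) :
  \pi_quoJ (x + y) = \pi_quoJ x + \pi_quoJ y.
Proof. exact: quotmod_piD. Qed.

Fact quoJ_mulA : associative quoJ_mul.
Proof.
elim/quotW=> x; elim/quotW=> y; elim/quotW=> z.
by rewrite (quoJ_mulE y) (quoJ_mulE x y) 2!quoJ_mulE mulrA.
Qed.
Fact quoJ_mul1r : left_id quoJ_one quoJ_mul.
Proof. by elim/quotW=> x; rewrite quoJ_mulE mul1r. Qed.
Fact quoJ_mulr1 : right_id quoJ_one quoJ_mul.
Proof. by elim/quotW=> x; rewrite quoJ_mulE mulr1. Qed.
Fact quoJ_mulDl : left_distributive quoJ_mul +%R.
Proof.
elim/quotW=> x; elim/quotW=> y; elim/quotW=> z.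
by rewrite -quoJ_piD !quoJ_mulE mulrDl quoJ_piD.
Qed.
Fact quoJ_mulDr : right_distributive quoJ_mul +%R.
Proof.
elim/quotW=> x; elim/quotW=> y; elim/quotW=> z.
by rewrite -quoJ_piD !quoJ_mulE mulrDr quoJ_piD.
Qed.

HB.instance Definition _ := GRing.Zmodule_isPzRing.Build quoJ
  quoJ_mulA quoJ_mul1r quoJ_mulr1 quoJ_mulDl quoJ_mulDr.

End Jacobson.

Definition semisimple_ring (R : pzRingType) : Prop :=
  semisimple_module (R^o : lmodType R).

(* J ^ n is additively generated by the products of n elements of J. *)
Definition nilpotent_ideal (R : pzRingType) (I : {pred R}) : Prop :=
  exists n, forall x : 'I_n -> R,
    (forall i, x i \in I) -> \prod_(i < n) x i = 0.

Definition semiprimary (A : pzRingType) : Prop :=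
  nilpotent_ideal (@jacobson A) /\ semisimple_ring (quoJ A).

Section Linear.
Variables (A : pzRingType) (U V : lmodType A).

Definition hom := {linear U -> V}.
Implicit Types f g : hom.

HB.instance Definition _ := gen_eqMixin hom.
HB.instance Definition _ := gen_choiceMixin hom.

Lemma homP f g : f =1 g -> f = g.
Proof.
move=> fg; have /funext := fg.
case: f g {fg} => [f [[f1] [f2]]] [g [[g1] [g2]]] /= fg; subst g.
by rewrite (Prop_irrelevance f1 g1) (Prop_irrelevance f2 g2).
Qed.

Definition hom0 : hom := \0.
Definition homN f : hom := \- f.
Definition homD f g : hom := f \+ g.

Fact homDA : associative homD.
Proof. by move=> f g h; apply: homP => x /=; rewrite addrA. Qed.
Fact homDC : commutative homD.
Proof. by move=> f g; apply: homP => x /=; rewrite addrC. Qed.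
Fact hom0D : left_id hom0 homD.
Proof. by move=> f; apply: homP => x /=; rewrite add0r. Qed.
Fact homND : left_inverse hom0 homN homD.
Proof. by move=> f; apply: homP => x /=; rewrite addNr. Qed.

HB.instance Definition _ := GRing.isZmodule.Build hom homDA homDC hom0D homND.

Lemma hom0E x : (0 : hom) x = 0. Proof. by []. Qed.
Lemma homDE f g x : (f + g) x = f x + g x. Proof. by []. Qed.
Lemma homNE f x : (- f) x = - f x. Proof. by []. Qed.
Lemma homBE f g x : (f - g) x = f x - g x. Proof. by []. Qed.

Definition mkhom (f : U -> V) (fl : linear f) : hom :=
  HB.pack f (GRing.isLinear.Build A U V *:%R f fl).

End Linear.

Definition homcomp (A : pzRingType) (U V W : lmodType A)
  (g : hom V W) (f : hom U V) : hom U W := g \o f.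

Section Image.
Variables (A : pzRingType) (U V : lmodType A).

Definition himage (g : hom U V) : {pred V} := fun v => `[< exists u, g u = v >].
Fact himage_submod (g : hom U V) : submod_closed (himage g).
Proof.
split=> [|a x y /asboolP[s <-] /asboolP[t <-]]; apply/asboolP.
  by exists 0; rewrite raddf0.
by exists (a *: s + t); rewrite linearP.
Qed.
HB.instance Definition _ (g : hom U V) :=
  GRing.isSubmodClosed.Build A V (himage g)
    (GRing.submod_closed_semi (himage_submod g)).

Definition hker (g : hom U V) : {pred U} := fun u => g u == 0.
Fact hker_submod (g : hom U V) : submod_closed (hker g).
Proof.
split=> [|a x y /eqP xK /eqP yK]; apply/eqP; first exact: raddf0.
by rewrite linearP xK yK scaler0 addr0.
Qed.
HB.instance Definition _ (g : hom U V) :=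
  GRing.isSubmodClosed.Build A U (hker g)
    (GRing.submod_closed_semi (hker_submod g)).

Lemma projective_lift (P : lmodType A) (g : hom U V) (f : hom P V) :
  projective P -> (forall x, exists u, g u = f x) ->
  exists h : hom P U, forall x, g (h x) = f x.
Proof.
move=> Pproj fg.
have gI u : g u \in himage g by apply/asboolP; exists u.
have fI x : f x \in himage g by apply/asboolP.
have gl : linear (fun u => Submod (gI u)).
  by move=> a x y; apply: val_inj; rewrite /= linearP.
have fl : linear (fun u => Submod (fI u)).
  by move=> a x y; apply: val_inj; rewrite /= linearP.
have [[v vI]|h hE] := Pproj _ _ (mkhom gl) (mkhom fl).
  by have /asboolP[u uv] := vI; exists u; apply: val_inj.
by exists h => x; have /(congr1 val) := hE x.
Qed.

End Image.

Section Free.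
Variables (A : pzRingType) (X : choiceType).

Definition fin_supported : {pred X -> A^o} :=
  fun f => `[< exists s : seq X, forall x, x \notin s -> f x = 0 >].
Fact fin_supported_submod : submod_closed fin_supported.
Proof.
split=> [|a f g /asboolP[s sf] /asboolP[t tg]]; apply/asboolP; first by exists [::].
exists (s ++ t) => x; rewrite mem_cat negb_or => /andP[xs xt].
by rewrite addrfctE scalrfctE sf // tg // scaler0 addr0.
Qed.
HB.instance Definition _ := GRing.isSubmodClosed.Build A (X -> A^o) fin_supported
  (GRing.submod_closed_semi fin_supported_submod).

Definition freemod : lmodType A := submod fin_supported.

Definition fcoef (a : freemod) (x : X) : A := (val a : X -> A^o) x.

Lemma fcoef_supp (a : freemod) :
  exists2 s : seq X, uniq s & forall x, x \notin s -> fcoef a x = 0.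
Proof.
have /asboolP[s sa] := valP a; exists (undup s); rewrite ?undup_uniq // => x.
by rewrite mem_undup; apply: sa.
Qed.

Variable U : lmodType A.

Definition free_ext_fun (u : X -> U) (a : freemod) : U :=
  \sum_(x \in [set: X]) fcoef a x *: u x.

Lemma free_ext_sum (u : X -> U) (a : freemod) (s : seq X) : uniq s ->
  (forall x, x \notin s -> fcoef a x = 0) ->
  free_ext_fun u a = \sum_(x <- s) fcoef a x *: u x.
Proof.
move=> s_uniq sa; rewrite /free_ext_fun (fsbigE s) //; last first.
  by move=> x _ xs; rewrite sa // scale0r.
by apply: eq_bigl => x; rewrite in_setT.
Qed.

Fact free_ext_linear (u : X -> U) : linear (free_ext_fun u).
Proof.
move=> r a b; have [s _ sa] := fcoef_supp a; have [t _ tb] := fcoef_supp b.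
have st_uniq := undup_uniq (s ++ t); set w := undup _ in st_uniq.
have wa x : x \notin w -> fcoef a x = 0.
  by rewrite mem_undup mem_cat negb_or => /andP[/sa].
have wb x : x \notin w -> fcoef b x = 0.
  by rewrite mem_undup mem_cat negb_or => /andP[_ /tb].
have wab x : x \notin w -> fcoef (r *: a + b) x = 0.
  move=> xw; rewrite -[LHS]/(r * fcoef a x + fcoef b x).
  by rewrite wa // wb // mulr0 addr0.
rewrite !(free_ext_sum u st_uniq) // scaler_sumr -big_split /=.
apply: eq_bigr => x _; rewrite scalerA -scalerDl.
by rewrite -[in RHS]/(fcoef (r *: a + b) x).
Qed.

Definition free_ext (u : X -> U) : hom freemod U := mkhom (free_ext_linear u).

Fact fbasis_subproof (x : X) :
  ((fun y => (y == x)%:R) : X -> A^o) \in fin_supported.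
Proof.
by apply/asboolP; exists [:: x] => y; rewrite inE => /negPf ->.
Qed.
Definition fbasis (x : X) : freemod := Submod (fbasis_subproof x).

Lemma free_extE (u : X -> U) x : free_ext u (fbasis x) = u x.
Proof.
rewrite -[LHS]/(free_ext_fun u (fbasis x)) (@free_ext_sum _ _ [:: x]) //.
  by rewrite big_seq1 /fcoef /= eqxx scale1r.
by move=> y; rewrite inE /fcoef /= => /negPf ->.
Qed.

End Free.

Lemma free_ext_id (A : pzRingType) (X : choiceType) (U : lmodType A)
  (f : hom (freemod A X) U) : f = free_ext (fun x => f (fbasis A x)).
Proof.
apply: homP => a; have [s s_uniq sa] := fcoef_supp a.
rewrite -[RHS]/(free_ext_fun _ a) (free_ext_sum _ s_uniq) //.
transitivity (f (\sum_(x <- s) fcoef a x *: fbasis A x)); last first.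
  by rewrite linear_sum; apply: eq_bigr => x _; rewrite linearZ.
congr (f _); apply: val_inj; apply/funext => y; rewrite raddf_sum fct_sumE /=.
have [ys|ys] := boolP (y \in s).
  rewrite (bigD1_seq y) //= big1 => [|x /negPf xy].
    by rewrite addr0 scalrfctE /= eqxx /GRing.scale /= mulr1.
  by rewrite scalrfctE /= eq_sym xy scaler0.
rewrite big_seq big1 => [|x xs]; first exact: sa.
rewrite scalrfctE /=; case: eqP => [yx|_]; last exact: scaler0.
by rewrite yx xs in ys.
Qed.

Lemma freemod_projective (A : pzRingType) (X : choiceType) :
  projective (freemod A X).
Proof.
move=> U V g f g_surj; have [u uE] := choice (fun x => g_surj (f (fbasis A x))).
exists (free_ext u) => a; rewrite [f]free_ext_id.
suff -> : free_ext (fun x => f (fbasis A x)) = homcomp g (free_ext u) by [].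
rewrite [RHS]free_ext_id; congr free_ext; apply/funext => x.
by rewrite -[RHS]/(g (free_ext u (fbasis A x))) free_extE uE.
Qed.

Record projres (A : pzRingType) (M : lmodType A) := ProjRes {
  res_obj :> nat -> lmodType A;
  res_d : forall n, hom (res_obj n.+1) (res_obj n);
  res_aug : hom (res_obj 0) M;
  res_projective : forall n, projective (res_obj n);
  res_aug_surj : forall m, exists x, res_aug x = m;
  res_exact0 : forall x, res_aug x = 0 <-> exists y, res_d 0 y = x;
  res_exactS : forall n x, res_d n x = 0 <-> exists y, res_d n.+1 y = x
}.

(* The standard free resolution: with [syzygy 0 = M], the n-th term is the
   free module on the underlying set of [syzygy n], and [syzygy n.+1] is the
   kernel of the evaluation of that term onto [syzygy n]. *)
Section FreeResolution.
Variables (A : pzRingType) (M : lmodType A).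

Definition free_cover (K : lmodType A) : hom (freemod A K) K := free_ext id.

Fixpoint syzygy (n : nat) : lmodType A :=
  if n is k.+1 then submod (hker (free_cover (syzygy k))) else M.

Definition free_obj (n : nat) : lmodType A := freemod A (syzygy n).

Definition free_aug : hom (free_obj 0) M := free_cover M.

Definition submod_incl (V : lmodType A) (W : submodClosed V) : hom (submod W) V :=
  (val : submod W -> V).

Definition free_d (n : nat) : hom (free_obj n.+1) (free_obj n) :=
  homcomp (submod_incl (hker (free_cover (syzygy n)))) (free_cover (syzygy n.+1)).

Lemma free_cover_surj (K : lmodType A) (k : K) : exists x, free_cover K x = k.
Proof. by exists (fbasis A k); rewrite free_extE. Qed.

Lemma free_exact (n : nat) (x : free_obj n) :
  free_cover (syzygy n) x = 0 <-> exists y, free_d n y = x.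
Proof.
split=> [x0|[y <-]]; last first.
  by apply/eqP; apply: (submod_valP (free_cover (syzygy n.+1) y)).
have xK : x \in hker (free_cover (syzygy n)) by apply/eqP.
have [y yx] := free_cover_surj (Submod xK : syzygy n.+1).
by exists y; rewrite -[LHS]/(val (free_cover (syzygy n.+1) y)) yx.
Qed.

Lemma free_exactS (n : nat) (x : free_obj n.+1) :
  free_d n x = 0 <-> exists y, free_d n.+1 y = x.
Proof.
rewrite -free_exact; split=> [x0|x0]; first exact: val_inj.
by rewrite -[LHS]/(val (free_cover (syzygy n.+1) x)) x0.
Qed.

Definition free_res : projres M :=
  @ProjRes A M free_obj free_d free_aug
    (fun n => @freemod_projective A (syzygy n))
    (@free_cover_surj M) (@free_exact 0) free_exactS.

End FreeResolution.

Lemma res_dd (A : pzRingType) (M : lmodType A) (P : projres M) n x :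
  res_d P n (res_d P n.+1 x) = 0.
Proof. by apply/res_exactS; exists x. Qed.

Lemma res_augd (A : pzRingType) (M : lmodType A) (P : projres M) x :
  res_aug P (res_d P 0 x) = 0.
Proof. by apply/res_exact0; exists x. Qed.

(* [ext P N n] is the n-th cohomology group of the complex Hom_A(P, N). *)
Section Ext.
Variables (A : pzRingType) (M : lmodType A) (P : projres M) (N : lmodType A).

Definition is_cocycle (n : nat) : {pred hom (P n) N} :=
  fun f => `[< forall x, f (res_d P n x) = 0 >].

Definition is_coboundary (n : nat) : {pred hom (P n) N} :=
  match n return hom (P n) N -> bool with
  | 0 => fun f => f == 0
  | k.+1 => fun f => `[< exists g : hom (P k) N, forall x, f x = g (res_d P k x) >]
  end.

Variable n : nat.

Fact is_cocycle_zmod : zmod_closed (@is_cocycle n).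
Proof.
split=> [|f g /asboolP f0 /asboolP g0]; apply/asboolP => x //.
by rewrite homBE f0 g0 subrr.
Qed.
HB.instance Definition _ := GRing.isZmodClosed.Build (hom (P n) N)
  (@is_cocycle n) is_cocycle_zmod.

Fact is_coboundary_zmod : zmod_closed (@is_coboundary n).
Proof.
case: n => [|k]; split=> [|f g]; rewrite ?unfold_in //=.
- by move=> /eqP -> /eqP ->; rewrite subrr.
- by apply/asboolP; exists 0.
move=> /asboolP[u fu] /asboolP[v gv]; apply/asboolP; exists (u - v) => x.
by rewrite !homBE fu gv.
Qed.
HB.instance Definition _ := GRing.isZmodClosed.Build (hom (P n) N)
  (@is_coboundary n) is_coboundary_zmod.

Record cocycle := Cocycle {
  cocycle_val : hom (P n) N;
  cocycle_valP : cocycle_val \in @is_cocycle n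
}.
HB.instance Definition _ := [isSub for cocycle_val].
HB.instance Definition _ := [Choice of cocycle by <:].
HB.instance Definition _ := [SubChoice_isSubZmodule of cocycle by <:].

Definition coboundary : {pred cocycle} := fun c => val c \in @is_coboundary n.
Fact coboundary_zmod : zmod_closed coboundary.
Proof. by split=> [|c e cB eB]; [exact: rpred0 | apply: rpredB]. Qed.
HB.instance Definition _ := GRing.isZmodClosed.Build cocycle
  coboundary coboundary_zmod.

Definition ext : Type := Quotient.quot coboundary.
HB.instance Definition _ := GRing.Zmodule.on ext.
HB.instance Definition _ := EqQuotient.on ext.

Definition ext_class (c : cocycle) : ext := \pi_ext c.

Lemma ext_classP (c e : cocycle) :
  ext_class c = ext_class e <-> val c - val e \in @is_coboundary n.
Proof.
rewrite -[X in _ <-> X]/(is_true (c - e \in coboundary)) Quotient.idealrBE.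
by split=> [/eqP|/eqP].
Qed.

Lemma ext_classD (c e : cocycle) :
  ext_class (c + e) = ext_class c + ext_class e.
Proof. by rewrite /ext_class [RHS]piE. Qed.

Lemma ext_class_repr (x : ext) : ext_class (repr x) = x.
Proof. exact: reprK. Qed.

Lemma cocycleP (c : cocycle) x : val c (res_d P n x) = 0.
Proof. by have /asboolP := cocycle_valP c. Qed.

Definition mkcocycle (f : hom (P n) N) (f0 : forall x, f (res_d P n x) = 0) :
  cocycle := Cocycle (asboolT f0 : f \in @is_cocycle n).

End Ext.

Section Lift.
Variables (A : pzRingType) (M N : lmodType A) (P : projres M) (Q : projres N).

Definition is_lift (n : nat) (f : hom (P n) N)
    (phi : forall i, hom (P (i + n)) (Q i)) : Prop :=
  (forall x : P n, res_aug Q (phi 0%N x) = f x) /\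
  (forall i (x : P (i + n).+1), res_d Q i (phi i.+1 x) = phi i (res_d P (i + n) x)).

Variable (n : nat) (f : cocycle P N n).

Let good i (phi : hom (P (i + n)) (Q i)) :=
  forall x, exists y, res_d Q i y = phi (res_d P (i + n) x).

Let lift_base : {phi : hom (P (0 + n)) (Q 0) |
  good phi /\ forall x : P n, res_aug Q (phi x) = val f x}.
Proof.
apply: cid; have [|phi phiE] :=
  @projective_lift _ _ _ (P (0 + n)) (res_aug Q) (val f) (@res_projective _ _ P n).
  by move=> x; apply: res_aug_surj.
exists phi; split=> // x; apply/res_exact0.
by rewrite phiE (cocycleP f).
Qed.

Let lift_step i (s : {phi : hom (P (i + n)) (Q i) | good phi}) :
  {psi : hom (P (i.+1 + n)) (Q i.+1) |
    good psi /\ forall x, res_d Q i (psi x) = sval s (res_d P (i + n) x)}.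
Proof.
apply: cid; case: s => phi phiP /=.
have [|psi psiE] := @projective_lift _ _ _ (P (i.+1 + n)) (res_d Q i)
  (homcomp phi (res_d P (i + n))) (@res_projective _ _ P _).
  exact: phiP.
exists psi; split=> // x; apply/res_exactS.
by rewrite psiE /= res_dd raddf0.
Qed.

Let lift_seq : forall i, {phi : hom (P (i + n)) (Q i) | good phi} :=
  fix F i := match i with
  | 0 => exist _ (sval lift_base) (svalP lift_base).1
  | k.+1 => exist _ (sval (lift_step (F k))) (svalP (lift_step (F k))).1
  end.

Lemma lift_exists : exists phi, is_lift (val f) phi.
Proof.
exists (fun i => sval (lift_seq i)); split=> [x|i x].
  exact: (svalP lift_base).2.
exact: (svalP (lift_step (lift_seq i))).2.
Qed.

Definition chain_lift : forall i, hom (P (i + n)) (Q i) := sval (cid lift_exists).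

Lemma chain_liftP : is_lift (val f) chain_lift.
Proof. exact: svalP (cid lift_exists). Qed.

End Lift.

Lemma coboundary_d (A : pzRingType) (M N : lmodType A) (P : projres M) n
    (c : hom (P n) N) : c \in @is_coboundary _ _ P N n ->
  forall x, c (res_d P n x) = 0.
Proof.
case: n c => [|k] c; rewrite unfold_in; first by move=> /eqP ->.
by move=> /asboolP[g cg] x; rewrite cg res_dd raddf0.
Qed.

Lemma coboundary_comp (A : pzRingType) (M N L : lmodType A) (P : projres M) n
    (g : hom N L) (c : hom (P n) N) : c \in @is_coboundary _ _ P N n ->
  homcomp g c \in @is_coboundary _ _ P L n.
Proof.
case: n c => [|k] c; rewrite !unfold_in => cB.
  by move/eqP: cB => ->; apply/eqP/homP => x /=; rewrite raddf0.
move/asboolP: cB => [h ch]; apply/asboolP.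
by exists (homcomp g h) => x; rewrite /= ch.
Qed.

Lemma lift_coboundary (A : pzRingType) (M N : lmodType A) (P : projres M)
    (Q : projres N) n (f : hom (P n) N) phi : is_lift f phi ->
  f \in @is_coboundary _ _ P N n ->
  forall i, exists u : hom (P (i + n)) (Q i.+1),
    phi i - homcomp (res_d Q i) u \in @is_coboundary _ _ P (Q i) (i + n).
Proof.
move=> [phi0 phiS] fB; elim=> [|i [u]].
  have [w wB wE] : exists2 w : hom (P (0 + n)) (Q 0),
    w \in @is_coboundary _ _ P (Q 0) (0 + n) &
    forall x, res_aug Q (w x) = f x.
    case: n f phi phi0 phiS fB => [|k] f phi phi0 phiS.
      rewrite unfold_in => /eqP f0.
      by exists 0; [exact: rpred0 | move=> x; rewrite f0 raddf0].
    rewrite unfold_in => /asboolP[h fh].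
    have [|w wh] := @projective_lift _ _ _ (P k) (res_aug Q) h
      (@res_projective _ _ P k); first by move=> x; apply: res_aug_surj.
    exists (homcomp w (res_d P k)); last by move=> x; rewrite /= wh fh.
    by apply/asboolP; exists w.
  have [|u uE] := @projective_lift _ _ _ (P (0 + n)) (res_d Q 0) (phi 0%N - w)
    (@res_projective _ _ P _).
    move=> x; apply/res_exact0; rewrite homBE linearB /= wE.
    by rewrite -[_ (phi 0%N x)]/(res_aug Q (phi 0%N (x : P n))) phi0 subrr.
  exists u; have -> // : phi 0%N - homcomp (res_d Q 0) u = w.
  by apply: homP => x; rewrite homBE /= uE homBE opprB addrC subrK.
set c := _ - _ => cB.
have cd x : c (res_d P (i + n) x) = 0.
  exact: coboundary_d cB x.
have [|v vE] := @projective_lift _ _ _ (P (i.+1 + n)) (res_d Q i.+1)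
  (phi i.+1 - homcomp u (res_d P (i + n))) (@res_projective _ _ P _).
  move=> x; apply/res_exactS; rewrite homBE linearB phiS /=.
  by have := cd x; rewrite homBE.
exists v; apply/asboolP; exists u => x.
by rewrite homBE /= vE homBE opprB addrC subrK.
Qed.

(* The Yoneda product Ext^m(N, L) x Ext^n(M, N) -> Ext^(m + n)(M, L): lift the
   cocycle f : P_n -> N to a chain map phi_i : P_(i + n) -> Q_i, without signs,
   and take the class of g \o phi_m.  With this convention the product is the
   splicing of extensions. *)
Section Yoneda.
Variables (A : pzRingType) (M N L : lmodType A) (P : projres M) (Q : projres N).
Variables (m n : nat).

Fact cup_cocycle (g : cocycle Q L m) (f : hom (P n) N)
    (phi : forall i, hom (P (i + n)) (Q i)) (fphi : is_lift f phi) x :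
  homcomp (val g) (phi m) (res_d P (m + n) x) = 0.
Proof. by rewrite /= -fphi.2 (cocycleP g). Qed.

Definition cup (g : cocycle Q L m) (f : hom (P n) N)
    (phi : forall i, hom (P (i + n)) (Q i)) (fphi : is_lift f phi) :
    cocycle P L (m + n) := mkcocycle (cup_cocycle g fphi).

Definition yoneda (y : ext Q L m) (x : ext P N n) : ext P L (m + n) :=
  ext_class (cup (repr y) (chain_liftP Q (repr x))).

Lemma cup_coboundary (g : cocycle Q L m) (f : hom (P n) N) phi :
  is_lift f phi -> (f \in @is_coboundary _ _ P N n) ->
  homcomp (val g) (phi m) \in @is_coboundary _ _ P L (m + n).
Proof.
move=> fphi fB; have [u] := lift_coboundary fphi fB m.
set c := _ - _ => cB.
have -> : homcomp (val g) (phi m) = homcomp (val g) c.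
  apply: homP => x; rewrite -[RHS]/(val g (phi m x - res_d Q m (u x))) linearB.
  by rewrite (cocycleP g) subr0.
exact: coboundary_comp.
Qed.

Lemma coboundary_cup (g : hom (Q m) L) (f : cocycle P N n) phi :
  is_lift (val f) phi -> g \in @is_coboundary _ _ Q L m ->
  homcomp g (phi m) \in @is_coboundary _ _ P L (m + n).
Proof.
move=> [_ phiS]; case: m g => [|k] g; rewrite unfold_in.
  move=> /eqP ->; suff -> : homcomp 0 (phi 0%N) = 0 :> hom _ L by exact: rpred0.
  exact: homP.
move=> /asboolP[h gh]; apply/asboolP; exists (homcomp h (phi k)) => x.
by rewrite /= gh phiS.
Qed.

Lemma is_liftB (f f' : hom (P n) N) (phi phi' : forall i, hom (P (i + n)) (Q i)) :
  is_lift f phi -> is_lift f' phi' ->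
  is_lift (f - f') (fun i => phi i - phi' i).
Proof.
move=> [p0 pS] [q0 qS]; split=> [x|i x].
  by rewrite !homBE linearB p0 q0.
by rewrite !homBE linearB pS qS.
Qed.

Lemma is_liftD (f f' : hom (P n) N) (phi phi' : forall i, hom (P (i + n)) (Q i)) :
  is_lift f phi -> is_lift f' phi' ->
  is_lift (f + f') (fun i => phi i + phi' i).
Proof.
move=> [p0 pS] [q0 qS]; split=> [x|i x].
  by rewrite !homDE linearD p0 q0.
by rewrite !homDE linearD pS qS.
Qed.

(* The product does not depend on the chosen representatives and lift. *)
Lemma yonedaE (g : cocycle Q L m) (f : cocycle P N n) phi
    (fphi : is_lift (val f) phi) :
  yoneda (ext_class g) (ext_class f) = ext_class (cup g fphi).
Proof.
have gB : val (repr (ext_class g)) - val g \in @is_coboundary _ _ Q L m.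
  by apply/ext_classP; rewrite ext_class_repr.
have fB : val (repr (ext_class f)) - val f \in @is_coboundary _ _ P N n.
  by apply/ext_classP; rewrite ext_class_repr.
apply/ext_classP => /=; set g' := repr _ in gB *; set f' := repr _ in fB *.
have -> : homcomp (val g') (chain_lift Q f' m) - homcomp (val g) (phi m) =
    homcomp (val g') (chain_lift Q f' m - phi m) + homcomp (val g' - val g) (phi m).
  apply: homP => x; rewrite -[RHS]/(val g' (chain_lift Q f' m x - phi m x) +
    (val g' (phi m x) - val g (phi m x))).
  by rewrite linearB addrA subrK.
apply: rpredD; last exact: coboundary_cup fphi gB.
exact: (cup_coboundary g' (is_liftB (chain_liftP Q f') fphi) fB).
Qed.

Lemma yonedaDl (y y' : ext Q L m) (x : ext P N n) :
  yoneda (y + y') x = yoneda y x + yoneda y' x.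
Proof.
rewrite -[x]ext_class_repr -[y]ext_class_repr -[y']ext_class_repr.
rewrite -ext_classD !(yonedaE _ (chain_liftP Q (repr x))) -ext_classD.
by congr ext_class; apply: val_inj; apply: homP.
Qed.

Lemma yonedaDr (y : ext Q L m) (x x' : ext P N n) :
  yoneda y (x + x') = yoneda y x + yoneda y x'.
Proof.
rewrite -[x]ext_class_repr -[y]ext_class_repr -[x']ext_class_repr.
rewrite -ext_classD.
have xx' := is_liftD (chain_liftP Q (repr x)) (chain_liftP Q (repr x')).
rewrite (@yonedaE _ (repr x + repr x') _ xx').
rewrite (yonedaE _ (chain_liftP Q (repr x))) (yonedaE _ (chain_liftP Q (repr x'))).
rewrite -ext_classD; congr ext_class; apply: val_inj; apply: homP => z.
exact: linearD.
Qed.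

End Yoneda.

Definition res_cast (A : pzRingType) (M : lmodType A) (P : projres M) a b
  (e : a = b) : hom (P a) (P b) := ecast k (hom (P a) (P k)) e (idfun : hom _ _).

Lemma res_cast_id (A : pzRingType) (M : lmodType A) (P : projres M) a
  (e : a = a) x : res_cast P e x = x.
Proof. by rewrite (eq_irrelevance e erefl). Qed.

Lemma res_castd (A : pzRingType) (M : lmodType A) (P : projres M) a b
  (e : a = b) (e' : a.+1 = b.+1) x :
  res_d P b (res_cast P e' x) = res_cast P e (res_d P a x).
Proof. by case: b / e e' => e'; rewrite !res_cast_id. Qed.

Section ExtCast.
Variables (A : pzRingType) (M N : lmodType A) (P : projres M).

Definition ext_cast a b (e : a = b) (x : ext P N a) : ext P N b :=
  ecast k (ext P N k) e x.

Lemma ext_cast_id a (e : a = a) x : ext_cast e x = x.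
Proof. by rewrite (eq_irrelevance e erefl). Qed.

Lemma ext_castD a b (e : a = b) : {morph ext_cast e : x y / x + y}.
Proof. by case: b / e. Qed.

Lemma ext_cast0 a b (e : a = b) : ext_cast e 0 = 0.
Proof. by case: b / e. Qed.

Lemma ext_cast_class a b (e : a = b) (c : cocycle P N a) (c' : cocycle P N b) :
  (forall x, val c x = val c' (res_cast P e x)) ->
  ext_cast e (ext_class c) = ext_class c'.
Proof.
by case: b / e c' => c' cc'; congr ext_class; apply: val_inj; apply: homP.
Qed.

End ExtCast.

Section YonedaAssoc.
Variables (A : pzRingType) (M N L K : lmodType A).
Variables (P : projres M) (Q : projres N) (R : projres L).
Variables (k m n : nat) (e : (k + (m + n) = k + m + n)%N).

Lemma yonedaA (z : ext R K k) (y : ext Q L m) (x : ext P N n) :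
  ext_cast e (yoneda z (yoneda y x)) = yoneda (yoneda z y) x.
Proof.
rewrite -[x]ext_class_repr -[y]ext_class_repr -[z]ext_class_repr.
set f := repr x; set g := repr y; set h := repr z.
have fl := chain_liftP Q f; have gl := chain_liftP R g.
have gfl : is_lift (val (cup g fl)) (fun i =>
    homcomp (chain_lift R g i) (homcomp (chain_lift Q f (i + m)) (res_cast P (addnA i m n)))).
  split=> [u|i u].
    by rewrite -[RHS]/(val g (chain_lift Q f m u)) -gl.1 /= res_cast_id.
  rewrite /= -(res_castd (addnA i m n) (addnA i.+1 m n)).
  rewrite -fl.2 -gl.2; reflexivity.
rewrite (yonedaE _ fl) (yonedaE _ gl) (yonedaE _ gfl) (yonedaE _ fl).
by apply: ext_cast_class => u /=; rewrite (eq_irrelevance (addnA k m n) e).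
Qed.

End YonedaAssoc.

Section YonedaUnit.
Variables (A : pzRingType) (M : lmodType A) (P : projres M).

Definition ext_one : ext P M 0 := ext_class (mkcocycle (@res_augd _ _ P)).

Lemma yoneda1l n (L : lmodType A) (Q : projres L) (x : ext Q M n) :
  yoneda ext_one x = x :> ext Q M n.
Proof.
rewrite -[x]ext_class_repr (yonedaE _ (chain_liftP P (repr x))).
apply: (ext_cast_class (e := erefl)) => u.
exact: (chain_liftP P (repr x)).1.
Qed.

Lemma yoneda1r n (N : lmodType A) (e : (n + 0 = n)%N) (x : ext P N n) :
  ext_cast e (yoneda x ext_one) = x.
Proof.
have l1 : is_lift (res_aug P) (fun i => res_cast P (addn0 i)).
  split=> [u|i u]; first by rewrite /= res_cast_id.
  exact: res_castd.
rewrite -[x]ext_class_repr.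
rewrite (@yonedaE _ _ _ _ _ _ _ _ (repr x) (mkcocycle (@res_augd _ _ P)) _ l1).
by apply: ext_cast_class => u /=; rewrite (eq_irrelevance (addn0 n) e).
Qed.

End YonedaUnit.

(* The ring of finitely supported families (x_n) with x_n in Ext^n(M, M),
   that is, the direct sum of the Ext^n(M, M). *)
Section ExtRing.
Variables (A : pzRingType) (M : lmodType A) (P : projres M).

Record extring := ExtRing {
  ext_comp : forall n, ext P M n;
  ext_finite : exists b, forall n, (b <= n)%N -> ext_comp n = 0
}.
Implicit Types x y z : extring.

HB.instance Definition _ := gen_eqMixin extring.
HB.instance Definition _ := gen_choiceMixin extring.

Lemma extringP x y : (forall n, ext_comp x n = ext_comp y n) -> x = y.
Proof.
move=> xy; have {}xy := functional_extensionality_dep xy.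
case: x y xy => [x xb] [y yb] /= xy; subst y.
by rewrite (Prop_irrelevance xb yb).
Qed.

Fact extring0_subproof :
  exists b, forall n, (b <= n)%N -> (fun n => 0 : ext P M n) n = 0.
Proof. by exists 0. Qed.
Definition extring0 : extring := ExtRing extring0_subproof.

Fact extringN_subproof x :
  exists b, forall n, (b <= n)%N -> - ext_comp x n = 0.
Proof.
by have [b xb] := ext_finite x; exists b => n /xb ->; rewrite oppr0.
Qed.
Definition extringN x : extring := ExtRing (extringN_subproof x).

Fact extringD_subproof x y :
  exists b, forall n, (b <= n)%N -> ext_comp x n + ext_comp y n = 0.
Proof.
have [a xa] := ext_finite x; have [b yb] := ext_finite y.
exists (a + b)%N => n abn; rewrite xa ?yb ?addr0 //.
  exact: leq_trans (leq_addl _ _) abn.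
exact: leq_trans (leq_addr _ _) abn.
Qed.
Definition extringD x y : extring := ExtRing (extringD_subproof x y).

Fact extringDA : associative extringD.
Proof. by move=> x y z; apply: extringP => n /=; rewrite addrA. Qed.
Fact extringDC : commutative extringD.
Proof. by move=> x y; apply: extringP => n /=; rewrite addrC. Qed.
Fact extring0D : left_id extring0 extringD.
Proof. by move=> x; apply: extringP => n /=; rewrite add0r. Qed.
Fact extringND : left_inverse extring0 extringN extringD.
Proof. by move=> x; apply: extringP => n /=; rewrite addNr. Qed.
HB.instance Definition _ := GRing.isZmodule.Build extring
  extringDA extringDC extring0D extringND.

Lemma ext_compD n : {morph ext_comp^~ n : x y / x + y}.
Proof. by []. Qed.

Lemma ext_comp0 n : ext_comp 0 n = 0. Proof. by []. Qed.

Lemma yoneda0l m n (x : ext P M n) : yoneda (0 : ext P M m) x = 0.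
Proof.
have /eqP := yonedaDl (0 : ext P M m) 0 x.
by rewrite addr0 -[X in X == _]addr0 (inj_eq (addrI _)) => /eqP.
Qed.

Lemma yoneda0r m n (y : ext P M m) : yoneda y (0 : ext P M n) = 0.
Proof.
have /eqP := yonedaDr y (0 : ext P M n) 0.
by rewrite addr0 -[X in X == _]addr0 (inj_eq (addrI _)) => /eqP.
Qed.

Definition extring_mul_comp x y n : ext P M n :=
  \sum_(i < n.+1)
    ext_cast (subnKC (leq_ord i)) (yoneda (ext_comp x i) (ext_comp y (n - i))).

Fact extring_mul_subproof x y :
  exists b, forall n, (b <= n)%N -> extring_mul_comp x y n = 0.
Proof.
have [a xa] := ext_finite x; have [b yb] := ext_finite y.
exists (a + b)%N => n abn; rewrite /extring_mul_comp big1 // => i _.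
have [ai|ia] := leqP a i; first by rewrite xa // yoneda0l ext_cast0.
rewrite yb ?yoneda0r ?ext_cast0 // leq_subRL ?leq_ord //.
by apply: leq_trans abn; rewrite leq_add2r ltnW.
Qed.
Definition extring_mul x y : extring := ExtRing (extring_mul_subproof x y).

Definition hcomp n (a : ext P M n) k : ext P M k :=
  if n =P k is ReflectT e then ext_cast e a else 0.

Lemma hcomp_id n (a : ext P M n) : hcomp a n = a.
Proof. by rewrite /hcomp; case: eqP => // e; rewrite ext_cast_id. Qed.

Lemma hcomp_neq n (a : ext P M n) k : n != k -> hcomp a k = 0.
Proof. by rewrite /hcomp; case: eqP. Qed.

Fact homog_subproof n (a : ext P M n) :
  exists b, forall k, (b <= k)%N -> hcomp a k = 0.
Proof. by exists n.+1 => k nk; rewrite hcomp_neq // ltn_eqF. Qed.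

Definition homog n (a : ext P M n) : extring := ExtRing (homog_subproof a).

Lemma extring_ind (C : extring -> Prop) :
  C 0 -> (forall x y, C x -> C y -> C (x + y)) -> (forall n a, C (@homog n a)) ->
  forall x, C x.
Proof.
move=> C0 CD Ch x; have [b xb] := ext_finite x.
suff -> : x = \sum_(i < b) homog (ext_comp x i).
  by elim/big_ind: _ => // i _; apply: Ch.
apply: extringP => k; rewrite (big_morph _ (ext_compD k) (ext_comp0 k)).
have [bk|kb] := leqP b k.
  rewrite xb // big1 // => i _; apply: hcomp_neq.
  by rewrite ltn_eqF // (leq_trans (ltn_ord i)).
rewrite (bigD1 (Ordinal kb)) //= hcomp_id big1 ?addr0 // => i ik.
by apply: hcomp_neq; apply: contraNneq ik => ik; apply/eqP/val_inj.
Qed.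

Lemma hcomp_yoneda i j (a : ext P M i) (b : ext P M j) k l n (e : (k + l = n)%N) :
  ext_cast e (yoneda (hcomp a k) (hcomp b l)) =
  if (i == k) && (j == l) then hcomp (yoneda a b) n else 0.
Proof.
case: n / e; have [ik|ik] := eqVneq i k; last first.
  by rewrite hcomp_neq // yoneda0l ext_cast0.
have [jl|jl] := eqVneq j l; last first.
  by rewrite [hcomp b l]hcomp_neq // yoneda0r ext_cast0.
by case: k / ik; case: l / jl; rewrite !hcomp_id.
Qed.

Lemma homogM i j (a : ext P M i) (b : ext P M j) :
  extring_mul (homog a) (homog b) = homog (yoneda a b).
Proof.
apply: extringP => n /=; rewrite /extring_mul_comp /=.
under eq_bigr do rewrite hcomp_yoneda.
have [ijn|ijn] := eqVneq (i + j)%N n; last first.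
  by rewrite big1 ?hcomp_neq // => k _; case: ifP.
have iln : (i < n.+1)%N by rewrite -ijn ltnS leq_addr.
have jE : j = (n - i)%N by rewrite -ijn addKn.
rewrite (bigD1 (Ordinal iln)) //= eqxx -jE eqxx /= big1 ?addr0 // => k kl.
by case: ifP => // /andP[/eqP ik _]; case/eqP: kl; apply: val_inj.
Qed.

Fact extring_mulDl : left_distributive extring_mul +%R.
Proof.
move=> x y z; apply: extringP => n; rewrite /= -big_split /=.
by apply: eq_bigr => i _; rewrite yonedaDl ext_castD.
Qed.
Fact extring_mulDr : right_distributive extring_mul +%R.
Proof.
move=> x y z; apply: extringP => n; rewrite /= -big_split /=.
by apply: eq_bigr => i _; rewrite yonedaDr ext_castD.
Qed.

Let mul0x x : extring_mul 0 x = 0.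
Proof. by apply: (addrI (extring_mul 0 x)); rewrite -extring_mulDl !addr0. Qed.
Let mulx0 x : extring_mul x 0 = 0.
Proof. by apply: (addrI (extring_mul x 0)); rewrite -extring_mulDr !addr0. Qed.

Lemma homog_cast n k (e : n = k) (a : ext P M n) : homog (ext_cast e a) = homog a.
Proof. by case: k / e. Qed.

Fact extring_mulA : associative extring_mul.
Proof.
move=> x y z; elim/extring_ind: x => [|x x' xE x'E|i a].
- by rewrite !mul0x.
- by rewrite !extring_mulDl xE x'E.
elim/extring_ind: y => [|y y' yE y'E|j b].
- by rewrite !(mul0x, mulx0).
- by rewrite !(extring_mulDl, extring_mulDr) yE y'E.
elim/extring_ind: z => [|z z' zE z'E|k c].
- by rewrite !mulx0.
- by rewrite !extring_mulDr zE z'E.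
by rewrite !homogM -(yonedaA (addnA i j k)) homog_cast.
Qed.

Definition extring1 : extring := homog (ext_one P).

Fact extring_mul1x : left_id extring1 extring_mul.
Proof.
elim/extring_ind=> [|x y xE yE|n a]; first exact: mulx0.
  by rewrite extring_mulDr xE yE.
by rewrite homogM yoneda1l.
Qed.
Fact extring_mulx1 : right_id extring1 extring_mul.
Proof.
elim/extring_ind=> [|x y xE yE|n a]; first exact: mul0x.
  by rewrite extring_mulDl xE yE.
by rewrite homogM -(homog_cast (addn0 n)) yoneda1r.
Qed.

HB.instance Definition _ := GRing.Zmodule_isPzRing.Build extring
  extring_mulA extring_mul1x extring_mulx1 extring_mulDl extring_mulDr.

Definition extring_degree (n : nat) : set extring :=
  [set x | forall k, k <> n -> ext_comp x k = 0].

End ExtRing.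

(* Ext is computed with the standard free resolution of its first argument. *)
Definition Ext (A : pzRingType) (n : nat) (M N : lmodType A) : zmodType :=
  ext (free_res M) N n.

Definition yoneda_ring (A : pzRingType) : pzRingType :=
  extring (free_res (quoJ A : lmodType A)).

Definition yoneda_degree (A : pzRingType) (n : nat) : set (yoneda_ring A) :=
  @extring_degree A _ (free_res (quoJ A : lmodType A)) n.

(* R_ n is the degree n component of R, and the sums below range over
   R_0 + ... + R_m. *)
Definition generated_in_finite_degrees (R : pzRingType) (R_ : nat -> set R) :
    Prop :=
  exists m : nat, forall S : {pred R}, subring_closed S ->
    (forall x : nat -> R, (forall i, R_ i (x i)) -> \sum_(i < m.+1) x i \in S) ->
    forall r, r \in S.

Definition pd_le (A : pzRingType) (M : lmodType A) (d : nat) : Prop :=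
  exists P : projres M, forall n, (d < n)%N -> forall x : P n, x = 0.

(* The left global dimension; for semiprimary rings it agrees with the right
   and the weak one. *)
Definition finite_gldim (A : pzRingType) : Prop :=
  exists d, forall M : lmodType A, pd_le M d.

(* Main.v *)
From HB Require Import structures.
From mathcomp Require Import all_boot all_order all_algebra.
From mathcomp Require Import all_classical.
Require Import Defs.

(** Throughout, T is A/J, a module of which every submodule has a complement.

    If every module has a projective resolution of length d, then Ext^n vanishes
    for n > d; in particular the Yoneda ring is the sum of its components of
    degree at most d, which therefore generate it.

    For the converse, write the identity of T as a sum of t endomorphisms e_j
    that factor through simple modules S_j ([quoJ_sum_simple_factors]).  In the
    Yoneda ring E, the product e_j y e_j factors through Ext^n(S_j, S_j) when y
    has degree n, so it is 0 for n at least m ([factor_sandwich_eq0]).  Take t + 1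
    elements of degree at least m and insert 1 = e_1 + ... + e_t around them: in
    every resulting word some e_j occurs twice, so their product is 0
    ([ideal_power_idempotents_eq0]).  Now let E be generated in degrees at most d.
    An element of large degree is a sum of products of many factors of positive
    degree, which group into t + 1 factors of degree at least m; hence E vanishes
    in large degrees ([generated_idempotents_bounded]).

    It remains to bound all resolutions once Ext^(k+1)(T, T) = 0
    ([ext_quoJ_eq0_resolution_length]).  A module V killed by J is a direct
    summand both of a power and of a copower of T.  As Ext commutes with powers in
    its second argument, Ext^(k+1)(T, V) = 0; filtering a module M by the elements
    that the successive powers of J kill, which exhausts M because J is nilpotent,
    gives Ext^(k+1)(T, M) = 0 for every M, so T has a projective resolution with
    terms in degrees at most k.  So do its copowers, hence the modules killed by
    J, and by the same filtration and the horseshoe lemma so does every module. *)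

Set Implicit Arguments.
Unset Strict Implicit.
Unset Printing Implicit Defensive.
Import GRing.Theory.
Local Open Scope classical_set_scope.
Local Open Scope quotient_scope.
Local Open Scope ring_scope.

(** * Submodules, quotients and linear maps *)

Lemma submod_of_set (A : pzRingType) (V : lmodType A) (P : V -> Prop) :
  P 0 -> (forall a x y, P x -> P y -> P (a *: x + y)) ->
  exists W : submodClosed V, forall x, x \in W <-> P x.
Proof.
move=> P0 PD.
have cl : submod_closed (fun x => `[< P x >] : bool).
  by split=> [|a x y /asboolP Px /asboolP Py]; apply/asboolP; [|apply: PD].
pose W : submodClosed V := HB.pack (fun x => `[< P x >] : bool)
  (GRing.isSubmodClosed.Build A V (fun x => `[< P x >] : bool)
     (GRing.submod_closed_semi cl)).
by exists W => x; split => [/asboolP|Px] //; apply/asboolP.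
Qed.

Lemma submodP (A : pzRingType) (V : lmodType A) (W : submodClosed V) a x y :
  x \in W -> y \in W -> a *: x + y \in W.
Proof. by move=> xW yW; rewrite rpredD ?rpredZ. Qed.

Lemma submodB (A : pzRingType) (V : lmodType A) (W : submodClosed V) x y :
  x \in W -> y \in W -> x - y \in W.
Proof. by move=> xW yW; rewrite addrC -scaleN1r submodP. Qed.

(** Linear maps out of quotients, and projections along a complement, are
    given by their graph. *)
Lemma hom_of_graph (A : pzRingType) (U V : lmodType A) (R : U -> V -> Prop) :
  (forall u, exists v, R u v) -> (forall v, R 0 v -> v = 0) ->
  (forall a u v u' v', R u v -> R u' v' -> R (a *: u + u') (a *: v + v')) ->
  exists h : hom U V, forall u, R u (h u).
Proof.
move=> /choice[f fR] R0 RD.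
have fl : linear f.
  move=> a x y; have := RD (-1) _ _ _ _ (fR (a *: x + y)) (RD a _ _ _ _ (fR x) (fR y)).
  by rewrite !scaleN1r !addNr => /R0/eqP; rewrite [- _ + _]addrC subr_eq0 => /eqP.
by exists (mkhom fl) => u; apply: fR.
Qed.

Lemma hom_factor (A : pzRingType) (U V W : lmodType A) (g : hom U V) (f : hom U W) :
  (forall v, exists u, g u = v) -> (forall u, g u = 0 -> f u = 0) ->
  exists h : hom V W, forall u, h (g u) = f u.
Proof.
move=> gS gf.
have [|||h hE] := @hom_of_graph _ V W (fun v w => exists2 u, g u = v & f u = w).
- by move=> v; have [u uv] := gS v; exists (f u), u.
- by move=> v [u /gf fu0 <-].
- move=> a _ _ _ _ [u <- <-] [u' <- <-].
  by exists (a *: u + u'); rewrite linearP.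
exists h => u; have [u' gu' <-] := hE (g u).
by apply/eqP; rewrite -subr_eq0 -linearB gf // linearB gu' subrr.
Qed.

Definition short_exact (A : pzRingType) (U V W : lmodType A)
  (i : hom U V) (p : hom V W) : Prop :=
  [/\ forall u, i u = 0 -> u = 0, forall w, exists v, p v = w &
      forall v, p v = 0 <-> exists u, i u = v].

Section Quotient.
Variables (A : pzRingType) (V : lmodType A) (W : submodClosed V).

Fact quot_proj_linear : linear (fun x : V => \pi_(quotmod W) x).
Proof. by move=> a x y; rewrite quotmod_piD -quotmod_scaleE. Qed.
Definition quot_proj : hom V (quotmod W) := mkhom quot_proj_linear.

Lemma quot_proj_surj w : exists v, quot_proj v = w.
Proof. by exists (repr w); rewrite -[RHS]reprK. Qed.

Lemma quot_proj0 v : quot_proj v = 0 <-> v \in W.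
Proof.
have {1}<- : quot_proj 0 = 0 by rewrite linear0.
rewrite -[v in X in _ <-> X]subr0 -quotmodE.
by split=> [vW|/eqP //]; apply/eqP.
Qed.

Lemma submod_quot_exact : short_exact (submod_incl W) quot_proj.
Proof.
split=> [u u0||v]; [exact: val_inj| exact: quot_proj_surj|].
rewrite quot_proj0; split=> [vW|[u <-]]; last exact: submod_valP.
by exists (Submod vW).
Qed.

End Quotient.

(** The union of a chain of submodules avoiding [B] avoids [B]: this gives both
    the maximal submodules of A/J and the complements below. *)
Lemma maximal_avoiding (A : pzRingType) (U : lmodType A) (W0 : submodClosed U)
    (B : set U) : (forall w, w \in W0 -> ~ B w) ->
  exists W : submodClosed U, [/\ {subset W0 <= W}, forall w, w \in W -> ~ B w &
    forall W1 : submodClosed U, {subset W <= W1} ->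
      (forall w, w \in W1 -> ~ B w) -> {subset W1 <= W}].
Proof.
move=> W0B.
pose good (X : set U) := exists2 W : submodClosed U, X = [set x | x \in W] &
  {subset W0 <= W} /\ forall w, w \in W -> ~ B w.
(* The empty set is admitted only as the union of the empty chain. *)
have [|X [[X0|[W XE [W0W WB]]] Xmax]] :=
    @Zorn_bigcup U [set X | X = set0 \/ good X].
- move=> F FP Ftot.
  have [|/existsNP[X0 /not_implyP[FX0 X0n]]] :=
      pselect (forall X, F X -> X = set0).
    move=> F0; left; rewrite -subset0 => x [X FX]; rewrite (F0 X FX); exact.
  have Fgood Y : F Y -> Y !=set0 -> good Y.
    by move=> /FP[->|//] [].
  have [W0' X0E [W0W0' _]] : good X0.
    by apply: Fgood => //; apply/set0P/eqP.
  have [||W WE] := @submod_of_set _ U (\bigcup_(X in F) X).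
  - by exists X0 => //; rewrite X0E /= rpred0.
  - move=> a x y [X FX Xx] [Y FY Yy].
    have [XY|YX] := Ftot _ _ FX FY.
      have [|W YE _] := Fgood _ FY; first by exists y.
      by exists Y => //; rewrite YE /= submodP //; have := XY _ Xx; move: Yy; rewrite YE.
    have [|W XE _] := Fgood _ FX; first by exists x.
    by exists X => //; rewrite XE /= submodP //; have := YX _ Yy; move: Xx; rewrite XE.
  right; exists W; first by apply/funext => x; apply/propext; rewrite /= WE.
  split=> [x xW0|w]; first by apply/WE; exists X0 => //; rewrite X0E /= W0W0'.
  move=> /WE[X FX Xw]; have [|W1 XE [_ W1B]] := Fgood _ FX; first by exists w.
  by apply: W1B; rewrite XE in Xw.
- have W0P : good [set x | x \in W0] by exists W0 => //; split=> // w /W0B.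
  have /Xmax[] : X `<` [set x | x \in W0]; last by right.
  by rewrite X0; split=> // /(_ 0); apply; rewrite /= rpred0.
exists W; split=> // W1 WW1 W1B x xW1; apply/negPn/negP => xW.
have W1P : good [set x | x \in W1].
  by exists W1 => //; split=> // y /W0W /WW1.
have /Xmax[] : X `<` [set x | x \in W1]; last by right.
by rewrite XE; split=> // /(_ x xW1); rewrite /= (negPf xW).
Qed.

(** * Modules killed by the radical *)

Definition radical_kills (A : pzRingType) (U : lmodType A) : Prop :=
  forall (a : A) (u : U), a \in @jacobson A -> a *: u = 0.

Section SemisimpleQuotient.
Variable A : pzRingType.
Notation T := (quoJ A : lmodType A).

Definition quoJ_proj : hom (A^o : lmodType A) T := quot_proj (@jacobson A).

Lemma quoJ_proj0 (a : A) : quoJ_proj a = 0 <-> a \in @jacobson A.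
Proof. exact: quot_proj0. Qed.

Lemma quoJ_proj_surj (t : T) : exists a : A, quoJ_proj a = t.
Proof. exact: (@quot_proj_surj A A^o (@jacobson A) t). Qed.

Lemma quoJ_projM (a b : A) : quoJ_proj (a * b) = a *: quoJ_proj b.
Proof. by rewrite -linearZ. Qed.

Lemma quoJ_proj_one (a : A) : quoJ_proj a = a *: quoJ_proj 1.
Proof. by rewrite -quoJ_projM mulr1. Qed.

Lemma radical_kills_quoJ : radical_kills T.
Proof.
move=> a t aJ; have [b <-] := quoJ_proj_surj t; rewrite -quoJ_projM.
by apply/quoJ_proj0; apply: jacobson_mulr.
Qed.

(** A module killed by J is a module over A/J, so each of its elements is the
    image of 1 under a map from A/J. *)
Lemma hom_from_quoJ (U : lmodType A) (u : U) : radical_kills U ->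
  exists f : hom T U, forall a : A, f (quoJ_proj a) = a *: u.
Proof.
move=> UJ; have ul : linear (fun a : A^o => (a : A) *: u : U).
  by move=> a x y; rewrite scalerDl -scalerA.
have [|f fE] := @hom_factor _ _ _ _ quoJ_proj (mkhom ul) quoJ_proj_surj.
  by move=> a /quoJ_proj0 aJ; apply: UJ.
by exists f => a; rewrite fE.
Qed.

Hypothesis ssA : semisimple_ring (quoJ A).

(** The A-submodules of A/J are its left ideals. *)
Lemma quoJ_semisimple : semisimple_module T.
Proof.
have scale_mul (a : A) (t : quoJ A) : (quoJ_proj a : quoJ A) * t = a *: (t : T).
  by have [b <-] := quoJ_proj_surj t; rewrite -quoJ_projM; apply: quoJ_mulE.
move=> W.
have [||W1 W1E] := @submod_of_set _ ((quoJ A)^o) (fun t => t \in W).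
- exact: rpred0.
- move=> r x y xW yW; have [a <-] := quoJ_proj_surj r.
  rewrite -[_ *: x]/((quoJ_proj a : quoJ A) * (x : quoJ A)) scale_mul.
  exact: submodP.
have [W2 [W12 W12T]] := ssA W1.
have [||W' W'E] := @submod_of_set _ T (fun t => t \in W2).
- exact: rpred0.
- move=> a x y xW yW.
  by rewrite -scale_mul; apply: (@submodP _ ((quoJ A)^o) W2 (quoJ_proj a)).
exists W'; split=> [v /W1E vW /W'E|v]; first exact: W12.
have [w [w' [/W1E wW w'W ->]]] := W12T v.
by exists w, w'; split=> //; apply/W'E.
Qed.

(** Take a submodule [W'] maximal among those meeting [W] in 0.  For u in U, the
    map A/J -> U sending 1 to u pulls [W + W'] back to a left ideal; by
    maximality its complement is mapped into [W'], so u is in [W + W']. *)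
Lemma radical_killed_semisimple (U : lmodType A) :
  radical_kills U -> semisimple_module U.
Proof.
move=> UJ W.
have [|Z ZE] := @submod_of_set _ U (fun x => x = 0) erefl.
  by move=> a _ _ -> ->; rewrite scaler0 addr0.
have [|W' [_ W'B W'max]] :=
    @maximal_avoiding _ U Z [set w | w \in W /\ w <> 0].
  by move=> w /ZE -> [].
exists W'; split=> [v vW vW'|u].
  by apply: contrapT => v0; apply: (W'B v).
have [f fE] := hom_from_quoJ u UJ.
pose sum x := exists w w', [/\ w \in W, w' \in W' & x = w + w'].
have sum0 : sum 0 by exists 0, 0; rewrite addr0 !rpred0.
have sumP a x y : sum x -> sum y -> sum (a *: x + y).
  move=> [v [v' [vW v'W ->]]] [w [w' [wW w'W ->]]].
  exists (a *: v + w), (a *: v' + w'); rewrite !submodP //; split=> //.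
  by rewrite scalerDr addrACA.
have [||I IE] := @submod_of_set _ T (fun t => sum (f t)).
- by rewrite linear0.
- by move=> a x y xI yI; rewrite linearP; apply: sumP.
have [C [IC ICT]] := quoJ_semisimple I.
have [i [c [/IE iI cC oneE]]] := ICT (quoJ_proj 1).
have <- : f (quoJ_proj 1) = u by rewrite fE scale1r.
rewrite oneE linearD -[f i]scale1r; apply: (sumP) => //.
exists 0, (f c); rewrite add0r rpred0; split=> //.
have [||W1 W1E] := @submod_of_set _ U
    (fun x => exists w' t, [/\ w' \in W', t \in C & x = w' + f t]).
- by exists 0, 0; rewrite linear0 addr0 !rpred0.
- move=> a _ _ [v [s [vW sC ->]]] [w [t [wW tC ->]]].
  exists (a *: v + w), (a *: s + t); rewrite !submodP //; split=> //.
  by rewrite linearP scalerDr addrACA.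
apply: (W'max W1); last first.
- by apply/W1E; exists 0, c; rewrite add0r rpred0.
- move=> x /W1E[w' [t [w'W tC ->]]] [xW xN0].
  have t0 : t = 0.
    apply: IC => //; apply/IE; exists (w' + f t), (- w'); split=> //.
      by rewrite -scaleN1r rpredZ.
    by rewrite addrC addKr.
  by apply: (W'B (w' + f t)) => //; rewrite t0 linear0 addr0.
by move=> x xW'; apply/W1E; exists x, 0; rewrite linear0 addr0 rpred0.
Qed.

Lemma radical_killed_split_inj (U V : lmodType A) (i : hom V U) :
  radical_kills U -> (forall v, i v = 0 -> v = 0) ->
  exists r : hom U V, forall v, r (i v) = v.
Proof.
move=> UJ i0; have [W [iW iWU]] := radical_killed_semisimple UJ (himage i).
have [|||r rE] := @hom_of_graph _ U V (fun u v => u - i v \in W).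
- move=> u; have [x [w [/asboolP[v <-] wW ->]]] := iWU u.
  by exists v; rewrite addrC addKr.
- move=> v; rewrite sub0r => ivW; apply/i0/eqP; rewrite -oppr_eq0; apply/eqP.
  by apply: iW => //; apply/asboolP; exists (- v); rewrite linearN.
- move=> a u v u' v' uW u'W.
  by rewrite linearP opprD addrACA -scalerBr submodP.
exists r => v; apply/eqP; rewrite eq_sym -subr_eq0; apply/eqP/i0.
rewrite linearB; apply: iW => //.
by rewrite -linearB; apply/asboolP; exists (v - r (i v)).
Qed.

Lemma radical_killed_split_surj (U V : lmodType A) (g : hom U V) :
  radical_kills U -> (forall v, exists u, g u = v) ->
  exists s : hom V U, forall v, g (s v) = v.
Proof.
move=> UJ gS; have [W [gW gWU]] := radical_killed_semisimple UJ (hker g).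
have [|||s sE] := @hom_of_graph _ V U (fun v u => u \in W /\ g u = v).
- move=> v; have [u <-] := gS v; have [k [w [/eqP k0 wW ->]]] := gWU u.
  by exists w; rewrite linearD k0 add0r.
- by move=> u [uW u0]; apply: gW => //; apply/eqP.
- by move=> a v u v' u' [uW <-] [u'W <-]; rewrite submodP // linearP.
by exists s => v; have [] := sE v.
Qed.

Record simple_factor := SimpleFactor {
  factor_mod : lmodType A;
  factor_simple : simple_module factor_mod;
  factor_proj : hom T factor_mod;
  factor_inj : hom factor_mod T
}.

(** The images of 1 under the endomorphisms of A/J that are sums of maps
    factoring through simple modules form a submodule.  Were it proper, it would
    lie in a maximal submodule L, and the projection onto a complement of L,
    which factors through the simple module (A/J)/L, would send 1 into L. *)
Lemma quoJ_sum_simple_factors : exists n (s : 'I_n -> simple_factor),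
  forall t : T, t = \sum_j factor_inj (s j) (factor_proj (s j) t).
Proof.
pose through (t : T) := exists n (s : 'I_n -> simple_factor),
  t = \sum_j factor_inj (s j) (factor_proj (s j) (quoJ_proj 1)).
have [||X XE] := @submod_of_set _ T through.
- by exists 0, (fun j : 'I_0 => False_rect simple_factor (notF (valP j))); rewrite big_ord0.
- move=> a x y [n [s ->]] [m [r ->]].
  have [f fE] := hom_from_quoJ (a *: quoJ_proj 1) radical_kills_quoJ.
  pose g i := SimpleFactor (factor_simple i) (homcomp (factor_proj i) f) (factor_inj i).
  exists (n + m)%N, (fun j => match fintype.split j with inl i => g (s i) | inr i => r i end).
  rewrite big_split_ord scaler_sumr; congr (_ + _); apply: eq_bigr => i _.
    by rewrite (unsplitK (inl i)) /= fE scale1r !linearZ.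
  by rewrite (unsplitK (inr i)).
have [|Xn1] := pselect (quoJ_proj 1 \in X).
  move=> /XE[n [s sE]]; exists n, s => t; have [a <-] := quoJ_proj_surj t.
  rewrite quoJ_proj_one {1}sE scaler_sumr; apply: eq_bigr => i _.
  by rewrite -!linearZ.
have [|L [XL L1 Lmax]] := @maximal_avoiding _ T X [set quoJ_proj 1].
  by move=> w wX w1; apply: Xn1; rewrite -w1.
have {}L1 : quoJ_proj 1 \notin L by apply/negP => /L1; apply.
have [C [LC LCT]] := quoJ_semisimple L.
have [|||p pE] := @hom_of_graph _ T T (fun u v => v \in C /\ u - v \in L).
- move=> u; have [l [c [lL cC ->]]] := LCT u.
  by exists c; rewrite addrK.
- by move=> v [vC vL]; apply: LC => //; rewrite -[v]opprK -scaleN1r rpredZ // -sub0r.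
- move=> a u v u' v' [vC uvL] [v'C uvL']; rewrite submodP //; split=> //.
  by rewrite opprD addrACA -scalerBr submodP.
have [|q qE] := @hom_factor _ _ _ _ (quot_proj L) p (@quot_proj_surj _ _ L).
  move=> u /quot_proj0 uL; have [pC upL] := pE u; apply: LC => //.
  by rewrite -[p u](subKr u) submodB.
have simpleL : simple_module (quotmod L : lmodType A).
  split=> [|W].
    by exists (quot_proj L (quoJ_proj 1)) => /quot_proj0; rewrite (negPf L1).
  have [||W1 W1E] := @submod_of_set _ T (fun t => quot_proj L t \in W).
  - by rewrite linear0 rpred0.
  - by move=> a x y xW yW; rewrite linearP submodP.
  have [/W1E oneW|W1n] := pselect (quoJ_proj 1 \in W1).
    right=> v; have [t <-] := quot_proj_surj v; have [a <-] := quoJ_proj_surj t.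
    by rewrite quoJ_proj_one linearZ rpredZ.
  left=> v; have [t <-] := quot_proj_surj v => tW; apply/quot_proj0.
  apply: (Lmax W1); last exact/W1E.
    by move=> x xL; apply/W1E; have /quot_proj0 -> := xL; rewrite rpred0.
  by move=> w wW1 w1; apply: W1n; rewrite -w1.
have [pC p1L] := pE (quoJ_proj 1).
have pX : p (quoJ_proj 1) \in X.
  apply/XE; exists 1, (fun=> SimpleFactor simpleL (quot_proj L) q).
  by rewrite big_ord1 /= qE.
by case/negP: L1; move: p1L; rewrite (LC _ (XL _ pX) pC) subr0.
Qed.

End SemisimpleQuotient.

(** Killing a power of J by induction: the elements killed by J form a
    submodule, and the quotient by it is killed by a smaller power. *)
Lemma semiprimary_module_ind (A : pzRingType) (C : lmodType A -> Prop) :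
  nilpotent_ideal (@jacobson A) ->
  (forall V, radical_kills V -> C V) ->
  (forall U V W (i : hom U V) (p : hom V W), short_exact i p -> C U -> C W -> C V) ->
  forall V, C V.
Proof.
move=> [n Jn] CJ Cext V.
have {Jn} : forall a : 'I_n -> A, (forall i, a i \in @jacobson A) ->
    forall v : V, \prod_(i < n) a i *: v = 0.
  by move=> a /Jn -> v; rewrite scale0r.
elim: n V => [|n IH] V Vn.
  have V0 (v : V) : v = 0.
    by have := Vn (fun=> 0); rewrite big_ord0 -[v]scale1r; apply=> -[].
  by apply: CJ => a v _; apply: V0.
have [||W WE] := @submod_of_set _ V (fun v => forall a : A, a \in @jacobson A -> a *: v = 0).
- by move=> a _; rewrite scaler0.
- move=> r x y x0 y0 a aJ; rewrite scalerDr y0 // scalerA x0 ?addr0 //.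
  exact: jacobson_mulr.
apply: (Cext _ _ _ _ _ (submod_quot_exact W)).
  by apply: CJ => a w aJ; apply: val_inj; have /WE := submod_valP w; apply.
apply: IH => a aJ v; have [u <-] := quot_proj_surj v; rewrite -linearZ.
apply/quot_proj0/WE => b bJ; rewrite scalerA.
have := Vn (fun i => if unlift ord0 i is Some j then a j else b).
rewrite big_ord_recl unlift_none; under eq_bigr do rewrite liftK.
by apply=> i; case: unliftP.
Qed.

(** * Projective modules and copowers *)

Lemma pair_equal (S T : Type) (x y : S * T) : x.1 = y.1 -> x.2 = y.2 -> x = y.
Proof. by case: x y => [? ?] [? ?] /= -> ->. Qed.

Section Projectives.
Variable A : pzRingType.
Implicit Types U V W P Q X : lmodType A.

Lemma projective_retract P Q (i : hom Q P) (r : hom P Q) :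
  (forall x, r (i x) = x) -> projective P -> projective Q.
Proof.
move=> ri Pproj U V g f gS; have [h hE] := Pproj _ _ g (homcomp f r) gS.
by exists (homcomp h i) => x; rewrite /= hE /= ri.
Qed.

Lemma projective_prod P Q :
  projective P -> projective Q -> projective (P * Q)%type.
Proof.
move=> Pproj Qproj U V g f gS.
have jl : linear (fun x : P => (x, 0) : P * Q).
  by move=> a x y; apply: pair_equal => //=; rewrite scaler0 addr0.
have jr : linear (fun y : Q => (0, y) : P * Q).
  by move=> a x y; apply: pair_equal => //=; rewrite scaler0 addr0.
have [h hE] := Pproj _ _ g (homcomp f (mkhom jl)) gS.
have [k kE] := Qproj _ _ g (homcomp f (mkhom jr)) gS.
have hk : linear (fun z : P * Q => h z.1 + k z.2).
  by move=> a x y; rewrite !linearP scalerDr addrACA.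
exists (mkhom hk) => -[x y] /=; rewrite linearD hE kE /= -linearD.
by congr (f _); apply: pair_equal; rewrite /= ?addr0 ?add0r.
Qed.

End Projectives.

(** A bound on the resolutions of U bounds those of its copowers, and every
    module killed by J is a retract of a copower of A/J. *)
Section Copower.
Variables (A : pzRingType) (X : choiceType).
Implicit Types U V W : lmodType A.

Section Def.
Variable U : lmodType A.

Definition finitely_supported : {pred X -> U} :=
  fun f => `[< exists s : seq X, forall x, x \notin s -> f x = 0 >].
Fact finitely_supported_submod : submod_closed finitely_supported.
Proof.
split=> [|a f g /asboolP[s sf] /asboolP[t tg]]; apply/asboolP; first by exists [::].
exists (s ++ t) => x; rewrite mem_cat negb_or => /andP[xs xt].
by rewrite addrfctE scalrfctE sf // tg // scaler0 addr0.
Qed.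
HB.instance Definition _ := GRing.isSubmodClosed.Build A (X -> U) finitely_supported
  (GRing.submod_closed_semi finitely_supported_submod).

Definition copower : lmodType A := submod finitely_supported.

Definition coord (f : copower) : X -> U := val f.

Lemma coord_supp (f : copower) :
  exists2 s : seq X, uniq s & forall x, x \notin s -> coord f x = 0.
Proof.
have /asboolP[s sf] := valP f; exists (undup s); rewrite ?undup_uniq // => x.
by rewrite mem_undup; apply: sf.
Qed.

Lemma coordP f g : coord f =1 coord g -> f = g.
Proof. by move=> fg; apply: val_inj; apply/funext. Qed.

Lemma coord_linear a f g x : coord (a *: f + g) x = a *: coord f x + coord g x.
Proof. by []. Qed.

Lemma copower_of (f : X -> U) (s : seq X) :
  (forall x, x \notin s -> f x = 0) -> exists g : copower, coord g = f.
Proof.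
by move=> sf; have fP : f \in finitely_supported by [apply/asboolP; exists s];
  exists (Submod fP).
Qed.

Fact single_subproof (x : X) (u : U) :
  (fun y => if y == x then u else 0) \in finitely_supported.
Proof. by apply/asboolP; exists [:: x] => y; rewrite inE => /negPf ->. Qed.

Fact single_linear (x : X) : linear (fun u => Submod (single_subproof x u) : copower).
Proof.
move=> a u v; apply: coordP => y; rewrite coord_linear /coord /=.
by case: eqP => // _; rewrite scaler0 addr0.
Qed.
Definition single (x : X) : hom U copower := mkhom (single_linear x).

Lemma coord_single x u y : coord (single x u) y = if y == x then u else 0.
Proof. by []. Qed.

Lemma coord_sum (I : Type) (s : seq I) (F : I -> copower) x :
  coord (\sum_(i <- s) F i) x = \sum_(i <- s) coord (F i) x.
Proof. exact: (big_morph (coord^~ x)). Qed.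

Lemma copower_sum (f : copower) (s : seq X) : uniq s ->
  (forall x, x \notin s -> coord f x = 0) -> f = \sum_(x <- s) single x (coord f x).
Proof.
move=> s_uniq sf; apply: coordP => y; rewrite coord_sum.
have [ys|ys] := boolP (y \in s); last first.
  rewrite sf // big_seq big1 // => x xs; rewrite coord_single.
  by case: eqP => // yx; rewrite yx xs in ys.
rewrite (bigD1_seq y) //= coord_single eqxx big1 ?addr0 // => x xy.
by rewrite coord_single eq_sym (negPf xy).
Qed.

Lemma copower_ext V (u : X -> hom U V) :
  exists h : hom copower V, forall x y, h (single x y) = u x y.
Proof.
pose value f (s : seq X) := \sum_(x <- s) u x (coord f x).
pose graph f v := exists s : seq X, [/\ uniq s,
  forall x, x \notin s -> coord f x = 0 & v = value f s].
(* The value does not depend on the list used to enumerate the support. *)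
have valueE f s t : uniq s -> uniq t -> (forall x, x \notin s -> coord f x = 0) ->
    {subset s <= t} -> value f t = value f s.
  move=> s_uniq t_uniq sf st; rewrite /value (bigID (mem s)) /= addrC big1 ?add0r.
    rewrite -big_filter; apply/perm_big/uniq_perm; rewrite ?filter_uniq // => x.
    by rewrite mem_filter; case: (boolP (x \in s)) => // /st ->.
  by move=> x /sf ->; rewrite linear0.
have [|||h hE] := @hom_of_graph _ copower V graph.
- by move=> f; have [s s_uniq sf] := coord_supp f; exists (value f s), s.
- by move=> _ [s [_ _ ->]]; rewrite /value big1 // => x _; rewrite linear0.
- move=> a f _ g _ [s [s_uniq sf ->]] [t [t_uniq tg ->]].
  have r_uniq := undup_uniq (s ++ t); set r := undup _ in r_uniq.
  have rf x : x \notin r -> x \notin s /\ x \notin t.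
    by rewrite mem_undup mem_cat negb_or => /andP.
  exists r; split=> // [x /rf[xs xt]|].
    by rewrite coord_linear sf // tg // scaler0 addr0.
  rewrite -(valueE f s r) // => [|x xs]; last by rewrite mem_undup mem_cat xs.
  rewrite -(valueE g t r) // => [|x xt]; last by rewrite mem_undup mem_cat xt orbT.
  rewrite /value scaler_sumr -big_split /=; apply: eq_bigr => x _.
  by rewrite coord_linear linearP.
exists h => x y; have [s [s_uniq sf ->]] := hE (single x y).
have sx : forall z, z \notin [:: x] -> coord (single x y) z = 0.
  by move=> z; rewrite inE coord_single => /negPf ->.
have r_uniq := undup_uniq (x :: s); set r := undup _ in r_uniq.
rewrite -(valueE _ s r) // => [|z zs]; last by rewrite mem_undup inE zs orbT.
rewrite (valueE _ [:: x]) // => [|z]; last by rewrite mem_undup !inE => /eqP ->; rewrite eqxx.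
by rewrite /value big_seq1 coord_single eqxx.
Qed.

Lemma copower_hom_eq V (f g : hom copower V) :
  (forall x y, f (single x y) = g (single x y)) -> forall z, f z = g z.
Proof.
move=> fg z; have [s s_uniq sz] := coord_supp z.
by rewrite (copower_sum s_uniq sz) !linear_sum; apply: eq_bigr.
Qed.

Lemma copower_projective : projective U -> projective copower.
Proof.
move=> Uproj V W g f gS.
have /choice[u uE] x := Uproj _ _ g (homcomp f (single x)) gS.
have [h hE] := copower_ext u; exists h.
have : forall z, homcomp g h z = f z; last by [].
by apply: copower_hom_eq => x y; rewrite /= hE uE.
Qed.

End Def.

Section Map.
Variables (U V : lmodType A) (g : hom U V).

Fact copower_map_subproof (f : copower U) :
  (fun x => g (coord f x)) \in @finitely_supported V.
Proof.
have [s _ sf] := coord_supp f; apply/asboolP; exists s => x /sf ->.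
exact: linear0.
Qed.
Fact copower_map_linear :
  linear (fun f => Submod (copower_map_subproof f) : copower V).
Proof.
by move=> a f h; apply: coordP => x; rewrite coord_linear /coord /= linearP.
Qed.
Definition copower_map : hom (copower U) (copower V) := mkhom copower_map_linear.

Lemma coord_map f x : coord (copower_map f) x = g (coord f x).
Proof. by []. Qed.

End Map.

Lemma copower_exact U V W (i : hom U V) (p : hom V W) :
  short_exact i p -> short_exact (copower_map i) (copower_map p).
Proof.
move=> [i0 pS ip]; split=> [f f0|h|f].
- by apply: coordP => x; apply: i0; rewrite -coord_map f0.
- have /choice[q qE] w : exists v, p v = w /\ (w = 0 -> v = 0).
    have [->|wN0] := eqVneq w 0; first by exists 0; rewrite linear0.
    by have [v vw] := pS w; exists v; split=> // w0; rewrite w0 eqxx in wN0.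
  have [s _ sh] := coord_supp h.
  have [f fE] := @copower_of V (fun x => q (coord h x)) s
    (fun x xs => (qE _).2 (sh x xs)).
  by exists f; apply: coordP => x; rewrite coord_map fE (qE _).1.
- split=> [f0|[e <-]]; last first.
    by apply: coordP => x; rewrite !coord_map; apply/ip; exists (coord e x).
  have /choice[e eE] x : exists u, i u = coord f x.
    by apply/ip; rewrite -coord_map f0.
  have [s _ sf] := coord_supp f.
  have [|e' e'E] := @copower_of U e s.
    by move=> x /sf fx0; apply: i0; rewrite eE.
  by exists e'; apply: coordP => x; rewrite coord_map e'E.
Qed.

End Copower.

(** * Lengths of projective resolutions *)

Section ResolutionLength.
Variable A : pzRingType.
Implicit Types U V W P Q X K : lmodType A.

(** Existence of a projective resolution with nonzero terms in degrees below n
    only; at n = 0 this says that the module vanishes, which makes every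
    induction below start trivially. *)
Fixpoint resolution_length (n : nat) (X : lmodType A) : Prop :=
  if n is k.+1 then
    exists (K P : lmodType A) (i : hom K P) (p : hom P X),
      [/\ projective P, short_exact i p & resolution_length k K]
  else forall x : X, x = 0.

Lemma resolution_length_projective P : projective P -> resolution_length 1 P.
Proof.
move=> Pproj; have [|K KE] := @submod_of_set _ P (fun x => x = 0) erefl.
  by move=> a _ _ -> ->; rewrite scaler0 addr0.
exists (submod K), P, (submod_incl K), (idfun : hom P P); split=> //.
  split=> [k k0|x|x]; [exact: val_inj|by exists x|].
  split=> [/= x0|[k <-]]; last exact/KE/submod_valP.
  by exists 0; rewrite x0.
by move=> k; apply: val_inj; apply/KE/submod_valP.
Qed.

(** The horseshoe lemma, one degree at a time. *)
Lemma resolution_length_ext n U V W (i : hom U V) (p : hom V W) :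
  short_exact i p -> resolution_length n U -> resolution_length n W ->
  resolution_length n V.
Proof.
elim: n U V W i p => [|n IH] U V W i p [i0 pS ip] /=.
  by move=> U0 W0 v; have /ip[u <-] := W0 (p v); rewrite (U0 u) linear0.
move=> [K [P [j [g [Pproj [j0 gS jg] Kn]]]]] [L [Q [k [h [Qproj [k0 hS kh] Ln]]]]].
have pi0 u : p (i u) = 0 by apply/ip; exists u.
have gj0 x : g (j x) = 0 by apply/jg; exists x.
have hk0 y : h (k y) = 0 by apply/kh; exists y.
have [q qE] := Qproj _ _ p h pS.
have fl : linear (fun z : P * Q => i (g z.1) + q z.2).
  by move=> a x y; rewrite !linearP scalerDr addrACA.
pose f : hom (P * Q)%type V := mkhom fl.
have pf z : p (f z) = h z.2.
  by rewrite linearD qE pi0 add0r.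
exists (submod (hker f)), (P * Q)%type, (submod_incl (hker f)), f; split.
- exact: projective_prod.
- split=> [x x0|v|z]; first exact: val_inj.
    have [y yE] := hS (p v).
    have [|u uE] := (ip (v - q y)).1; first by rewrite linearB qE yE subrr.
    by have [x xE] := gS u; exists (x, y); rewrite /= xE uE subrK.
  split=> [z0|[[z' z'K] <-]]; last exact/eqP.
  by have zK : z \in hker f by [apply/eqP]; exists (Submod zK).
(* The kernels of g, f and h form a short exact sequence again. *)
have incl_l x : (j x, 0) \in hker f.
  apply/eqP; rewrite /f /= linear0 addr0.
  by rewrite gj0 linear0.
have ll : linear (fun x => Submod (incl_l x)).
  move=> a x y; apply: val_inj; rewrite /= linearP.
  by apply: pair_equal => //=; rewrite scaler0 addr0.
have [|||r rE] := @hom_of_graph _ (submod (hker f)) L (fun z y => k y = (val z).2).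
- by move=> [z zK] /=; apply/kh; rewrite -pf; have /eqP -> := zK; rewrite linear0.
- by move=> y; apply: k0.
- by move=> a z y z' y' zy z'y'; rewrite linearP zy z'y'.
apply: (IH _ _ _ (mkhom ll) r) => //; split=> [x|y|z].
- by move=> /(congr1 (fun z => (val z).1)) /= /j0.
- have [|u uE] := (ip (- q (k y))).1.
    by rewrite linearN qE hk0 oppr0.
  have [x xE] := gS u.
  have zK : (x, k y) \in hker f by apply/eqP; rewrite /f /= xE uE addNr.
  exists (Submod zK); apply/eqP; rewrite -subr_eq0; apply/eqP/k0.
  by rewrite linearB rE subrr.
split=> [z0|[x <-]]; last by apply: k0; rewrite rE.
have z2 : (val z).2 = 0 by rewrite -rE z0 linear0.
have [|x xE] := (jg (val z).1).1.
  have /eqP := valP z; rewrite /f /= z2 linear0 addr0; exact: i0.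
by exists x; apply: val_inj; apply: pair_equal; rewrite /= ?xE ?z2.
Qed.

Lemma resolution_length_copower n (X : choiceType) U :
  resolution_length n U -> resolution_length n (copower X U).
Proof.
elim: n U => [|n IH] U /=; first by move=> U0 f; apply: coordP => x; apply: U0.
move=> [K [P [i [p [Pproj ip Kn]]]]].
exists (copower X K), (copower X P), (copower_map X i), (copower_map X p).
by split; [apply: copower_projective|apply: copower_exact|apply: IH].
Qed.

Lemma resolution_length_projres n X : resolution_length n X ->
  exists P : projres X, forall k, (n <= k)%N -> forall x : P k, x = 0.
Proof.
elim: n X => [|n IH] X /=.
  move=> X0; have Xproj : projective X.
    by move=> U V g f _; exists (0 : hom X U) => x; rewrite (X0 x) !linear0.
  have exact_all (f g : hom X X) x : f x = 0 <-> exists y, g y = x.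
    by split=> _; [exists x|]; rewrite [LHS]X0 [RHS]X0.
  exists (@ProjRes _ X (fun=> X) (fun=> 0) (idfun : hom X X) (fun=> Xproj)
    (fun x => ex_intro _ x erefl) (exact_all _ _) (fun=> exact_all _ _)).
  by move=> k _ x; apply: X0.
move=> [K [P [i [p [Pproj [i0 pS ip] /IH[Q Q0]]]]]].
pose obj k : lmodType A := if k is j.+1 then Q j else P.
pose d k : hom (obj k.+1) (obj k) :=
  if k is j.+1 then res_d Q j else homcomp i (res_aug Q).
have proj_obj k : projective (obj k) by case: k => // k; apply: res_projective.
have exact0 x : p x = 0 <-> exists y, d 0%N y = x.
  rewrite ip; split=> [[k <-]|[y <-]]; last by exists (res_aug Q y).
  by have [y <-] := res_aug_surj Q k; exists y.
have exactS k x : d k x = 0 <-> exists y, d k.+1 y = x.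
  case: k x => [|k] x; last exact: res_exactS.
  rewrite -[d 1%N]/(res_d Q 0) -res_exact0; split=> [/i0 //|/= ->].
  exact: linear0.
by exists (@ProjRes _ X obj d p proj_obj pS exact0 exactS) => -[|k] //=; apply: Q0.
Qed.

End ResolutionLength.

(** * Vanishing of Ext *)

Section YonedaZero.
Variables (A : pzRingType) (L M N : lmodType A) (P : projres M) (Q : projres N).
Variables m n : nat.

Lemma yoneda_0l (x : ext P N n) : yoneda (0 : ext Q L m) x = 0.
Proof. by apply: (addrI (yoneda (0 : ext Q L m) x)); rewrite -yonedaDl !addr0. Qed.

Lemma yoneda_0r (y : ext Q L m) : yoneda y (0 : ext P N n) = 0.
Proof. by apply: (addrI (yoneda y (0 : ext P N n))); rewrite -yonedaDr !addr0. Qed.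

End YonedaZero.

Lemma ext_cast_eq0 (A : pzRingType) (M N : lmodType A) (P : projres M) a b
  (e : a = b) (x : ext P N a) : ext_cast e x = 0 -> x = 0.
Proof. by case: b / e; rewrite ext_cast_id. Qed.

Lemma hom_sumE (A : pzRingType) (U V : lmodType A) (I : Type) (s : seq I)
  (F : I -> hom U V) x : (\sum_(j <- s) F j) x = \sum_(j <- s) F j x.
Proof. exact: (big_morph (fun f : hom U V => f x)). Qed.

Section HomClass.
Variable A : pzRingType.
Implicit Types L M N : lmodType A.

Fact hom_class_subproof M N (P : projres M) (f : hom M N) x :
  homcomp f (res_aug P) (res_d P 0 x) = 0.
Proof. by rewrite /= res_augd linear0. Qed.

(** The identification of Hom(M, N) with Ext^0(M, N). *)
Definition hom_class M N (P : projres M) (f : hom M N) : ext P N 0 :=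
  ext_class (mkcocycle (@hom_class_subproof _ _ P f)).

Lemma hom_class1 M (P : projres M) (f : hom M M) :
  (forall x, f x = x) -> hom_class P f = ext_one P.
Proof. by move=> f1; congr ext_class; apply: val_inj; apply: homP => x /=. Qed.

Lemma hom_classD M N (P : projres M) (f g : hom M N) :
  hom_class P (f + g) = hom_class P f + hom_class P g.
Proof. by rewrite -ext_classD; congr ext_class; apply: val_inj; apply: homP. Qed.

Lemma hom_class_sum M N (P : projres M) (I : Type) (s : seq I) (F : I -> hom M N) :
  hom_class P (\sum_(j <- s) F j) = \sum_(j <- s) hom_class P (F j).
Proof.
apply: (big_morph _ (hom_classD P)).
by apply: (addrI (hom_class P 0)); rewrite -hom_classD !addr0.
Qed.

Lemma hom_classM L M N (P : projres L) (Q : projres M) (f : hom L M) (g : hom M N) :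
  yoneda (hom_class Q g) (hom_class P f) = hom_class P (homcomp g f).
Proof.
rewrite (yonedaE _ (chain_liftP Q _)); congr ext_class.
apply: val_inj; apply: homP => x /=; congr (g _).
exact: (chain_liftP Q _).1.
Qed.

(** With r o i = 1, every x in Ext^n(M, L) equals (x . [r]) . [i], and x . [r]
    lies in Ext^n(N, L).  For M = N this compares two resolutions. *)
Lemma ext_eq0_retract M N (P : projres M) (Q : projres N) (i : hom M N) (r : hom N M) n :
  (forall x, r (i x) = x) ->
  (forall L (x : ext Q L n), x = 0) -> forall L (x : ext P L n), x = 0.
Proof.
move=> ri Q0 L x.
have {}Q0 K (y : ext Q K (n + 0)) : y = 0 by move: y; rewrite addn0.
have e : (n + (0 + 0) = n + 0 + 0)%N by rewrite !addn0.
rewrite -[x](yoneda1r (addn0 n)) -(@hom_class1 _ P (homcomp r i)) //.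
rewrite -(hom_classM P Q); set y := yoneda x _.
have -> : y = 0.
  by apply: (@ext_cast_eq0 _ _ _ _ _ _ e); rewrite yonedaA [yoneda x _]Q0 yoneda_0l.
exact: ext_cast0.
Qed.

End HomClass.

Section ExtVanishing.
Variable A : pzRingType.
Implicit Types L M N X : lmodType A.

Lemma ext_class_eq0 M N (P : projres M) n (c : cocycle P N n) :
  ext_class c = 0 <-> val c \in @is_coboundary _ _ P N n.
Proof.
have class0 : ext_class (0 : cocycle P N n) = 0.
  by apply: (addrI (ext_class (0 : cocycle P N n))); rewrite -ext_classD !addr0.
by rewrite -class0 ext_classP /= subr0.
Qed.

Lemma ext_eq0P M N (P : projres M) k :
  (forall x : ext P N k.+1, x = 0) <->
  forall f : hom (P k.+1) N, (forall x, f (res_d P k.+1 x) = 0) ->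
    exists g : hom (P k) N, forall x, f x = g (res_d P k x).
Proof.
split=> [P0 f f0|H x].
  by have /ext_class_eq0 := P0 (ext_class (mkcocycle f0)); apply: asboolW.
rewrite -[x]ext_class_repr; apply/ext_class_eq0/asboolP.
exact/H/cocycleP.
Qed.

Lemma projres_ext_eq0 M (P : projres M) n : (forall x : P n, x = 0) ->
  forall L (x : Ext n M L), x = 0.
Proof.
move=> P0; apply: (@ext_eq0_retract _ _ _ _ P (idfun : hom M M) (idfun : hom M M)) => // L x.
rewrite -[x]ext_class_repr; apply/ext_class_eq0.
have -> : val (repr x) = 0 by apply: homP => y; rewrite (P0 y) !linear0.
exact: rpred0.
Qed.

(** The standard resolution can be stopped as soon as a syzygy is projective. *)
Lemma resolution_length_syzygy X k n :
  resolution_length n (syzygy X k) -> resolution_length (k + n) X.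
Proof.
elim: k n => [//|k IH] n Xn; rewrite addSnnS; apply: IH.
exists (syzygy X k.+1), (freemod A (syzygy X k)).
exists (submod_incl (hker (free_cover (syzygy X k)))), (free_cover (syzygy X k)).
split=> //; first exact: freemod_projective.
split=> [x x0|x|x]; [exact: val_inj|exact: free_cover_surj|].
split=> [x0|[y <-]]; last exact/eqP/(submod_valP y).
have xK : x \in hker (free_cover (syzygy X k)) by apply/eqP.
by exists (Submod xK).
Qed.

(** Vanishing against the (k+1)-st syzygy splits its inclusion into the k-th
    free module, so the k-th syzygy is projective. *)
Lemma ext_eq0_resolution_length X k :
  (forall M (x : Ext k.+1 X M), x = 0) -> resolution_length k.+1 X.
Proof.
move=> X0; rewrite -addn1; apply: resolution_length_syzygy.
apply: resolution_length_projective.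
pose c j : hom (freemod A (syzygy X j)) (syzygy X j) := free_cover (syzygy X j).
have cS j x : exists y, c j y = x by apply: free_cover_surj.
have /ext_eq0P/(_ (c k.+1))[|g gE] := X0 (syzygy X k.+1).
  by move=> x; apply/eqP/(submod_valP (c k.+2 x)).
have gK (y : syzygy X k.+1) : g (val y) = y.
  by have [x <-] := cS k.+1 y; apply: esym (gE x).
pose incl : hom (syzygy X k.+1) (freemod A (syzygy X k)) := submod_incl (hker (c k)).
have [|||s sE] := @hom_of_graph _ (syzygy X k) (freemod A (syzygy X k))
    (fun y x => c k x = y /\ g x = 0).
- move=> y; have [x <-] := cS k y; exists (x - incl (g x)).
  rewrite !linearB; have /eqP -> := submod_valP (g x).
  by rewrite subr0 gK subrr.
- move=> x [/eqP xK x0]; pose y : syzygy X k.+1 := @Submod _ _ (hker (c k)) x xK.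
  by rewrite -[x]/(val y) -(gK y) [g _]x0.
- by move=> a x u y v [<- x0] [<- y0]; rewrite !linearP x0 y0 scaler0 addr0.
apply: (@projective_retract _ (freemod A (syzygy X k)) _ s (c k)).
  by move=> x; have [] := sE x.
exact: freemod_projective.
Qed.

(** The middle of the long exact sequence in the second variable. *)
Lemma ext_eq0_ext M (P : projres M) k L N K (i : hom L N) (p : hom N K) :
  short_exact i p -> (forall x : ext P L k.+1, x = 0) ->
  (forall x : ext P K k.+1, x = 0) -> forall x : ext P N k.+1, x = 0.
Proof.
move=> [i0 pS ip] /ext_eq0P PL /ext_eq0P PK; apply/ext_eq0P => f f0.
have [|g gE] := PK (homcomp p f); first by move=> x; rewrite /= f0 linear0.
have [h hE] := @res_projective _ _ P k _ _ p g pS.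
have [||e eE] := @projective_lift _ _ _ (P k.+1) i (f - homcomp h (res_d P k)).
- exact: res_projective.
- by move=> x; apply/ip; rewrite linearB [p (f x)]gE /= hE subrr.
have [|e' e'E] := PL e.
  by move=> x; apply: i0; rewrite eE homBE f0 /= res_dd linear0 subrr.
exists (homcomp i e' + h) => x.
by rewrite homDE /= -e'E eE homBE subrK.
Qed.

(** Hom_A(P_k, -) commutes with arbitrary powers, hence so does Ext^k; this is
    why a semisimple module is embedded below in a power, not in a copower. *)
Lemma ext_eq0_power M (P : projres M) k N (X : Type) :
  (forall x : ext P N k.+1, x = 0) -> forall x : ext P (X -> N) k.+1, x = 0.
Proof.
move=> /ext_eq0P PN; apply/ext_eq0P => f f0.
have evl j : linear (fun u : X -> N => u j) by [].
have /choice[g gE] j : exists g : hom (P k) N, forall x, f x j = g (res_d P k x).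
  by apply: (PN (homcomp (mkhom (evl j)) f)) => x; rewrite /= f0.
have gl : linear (fun x j => g j x).
  by move=> a x y; apply/funext => j; rewrite linearP.
by exists (mkhom gl) => x; apply/funext => j; rewrite gE.
Qed.

Lemma ext_eq0_retract2 M (P : projres M) k L N (i : hom L N) (r : hom N L) :
  (forall x, r (i x) = x) ->
  (forall x : ext P N k.+1, x = 0) -> forall x : ext P L k.+1, x = 0.
Proof.
move=> ri /ext_eq0P PN; apply/ext_eq0P => f f0.
have [|g gE] := PN (homcomp i f); first by move=> x; rewrite /= f0 linear0.
by exists (homcomp r g) => x; rewrite -[f x]ri [i _]gE.
Qed.

End ExtVanishing.

Section Semiprimary.
Variable A : pzRingType.
Hypothesis hA : semiprimary A.
Notation T := (quoJ A : lmodType A).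

Lemma radical_killed_copower_retract (V : lmodType A) : radical_kills V ->
  exists (X : choiceType) (i : hom V (copower X T)) (r : hom (copower X T) V),
    forall v, r (i v) = v.
Proof.
move=> VJ; have [_ ssA] := hA.
have /choice[u uE] v := hom_from_quoJ v VJ.
have [g gE] := copower_ext u.
have [||s sE] := @radical_killed_split_surj _ ssA (copower V T) V g.
- by move=> a f aJ; apply: coordP => x; apply: radical_kills_quoJ aJ.
- by move=> v; exists (single _ v (quoJ_proj A 1)); rewrite gE uE scale1r.
by exists V, s, g.
Qed.

Lemma radical_killed_power_retract (V : lmodType A) : radical_kills V ->
  exists (X : choiceType) (i : hom V (X -> T)) (r : hom (X -> T) V),
    forall v, r (i v) = v.
Proof.
move=> VJ; have [_ ssA] := hA.
have [X [i [r ri]]] := radical_killed_copower_retract VJ.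
pose j : hom (copower X T) (X -> T) := submod_incl _.
have [||s sE] := @radical_killed_split_inj _ ssA (X -> T) (copower X T) j.
- by move=> a f aJ; apply/funext => x; apply: radical_kills_quoJ aJ.
- by move=> f f0; apply: val_inj.
by exists X, (homcomp j i), (homcomp r s) => v; rewrite /= sE ri.
Qed.

(** Each step passes from modules killed by J to all modules along short exact
    sequences: first in the second variable of Ext^(k+1)(A/J, -), which bounds
    the resolution of A/J, then for the lengths of resolutions. *)
Lemma ext_quoJ_eq0_resolution_length k :
  (forall x : Ext k.+1 T T, x = 0) ->
  forall V : lmodType A, resolution_length k.+1 V.
Proof.
move=> TT; have [nilJ ssA] := hA.
have TV (V : lmodType A) (x : Ext k.+1 T V) : x = 0.
  move: V x; apply: (semiprimary_module_ind nilJ) => [V VJ|U V W i p ip TU TW].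
    have [X [i [r ri]]] := radical_killed_power_retract VJ.
    exact: (ext_eq0_retract2 ri (ext_eq0_power (X := X) TT)).
  exact: (ext_eq0_ext ip TU TW).
have resT := ext_eq0_resolution_length TV.
apply: (semiprimary_module_ind nilJ) => [V VJ|U V W i p]; last exact: resolution_length_ext.
have [X [i [r ri]]] := radical_killed_copower_retract VJ.
apply: ext_eq0_resolution_length.
have [P P0] := resolution_length_projres (resolution_length_copower X resT).
apply: (ext_eq0_retract (Q := free_res _) ri) => L.
exact: projres_ext_eq0 (P0 _ (leqnn _)) L.
Qed.

End Semiprimary.

(** * Powers of ideals *)

Section IdealPower.
Variable R : pzRingType.
Implicit Types (I H : R -> Prop) (Q : R -> Prop).

(** The powers of a two-sided ideal, with R itself as the zeroth one. *)
Inductive ideal_power I : nat -> R -> Prop :=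
| IdealPowerAll r : ideal_power I 0 r
| IdealPower0 n : ideal_power I n 0
| IdealPowerD n x y : ideal_power I n x -> ideal_power I n y -> ideal_power I n (x + y)
| IdealPowerM n x y : I x -> ideal_power I n y -> ideal_power I n.+1 (x * y).

Lemma ideal_power_sum I n (J : Type) (s : seq J) (P : pred J) (F : J -> R) :
  (forall j, P j -> ideal_power I n (F j)) -> ideal_power I n (\sum_(j <- s | P j) F j).
Proof. by move=> IF; elim/big_ind: _ => //; [exact: IdealPower0|exact: IdealPowerD]. Qed.

Section LeftIdeal.
Variable I : R -> Prop.
Hypothesis IL : forall r x, I x -> I (r * x).

Lemma ideal_power_mull n r x : ideal_power I n x -> ideal_power I n (r * x).
Proof.
elim=> [s|k|k y z _ IHy _ IHz|k y z Iy Iz _]; first exact: IdealPowerAll.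
- by rewrite mulr0; apply: IdealPower0.
- by rewrite mulrDr; apply: IdealPowerD.
- by rewrite mulrA; apply: IdealPowerM => //; apply: IL.
Qed.

Lemma ideal_power_opp n x : ideal_power I n x -> ideal_power I n (- x).
Proof. by rewrite -mulN1r; apply: ideal_power_mull. Qed.

Lemma ideal_power_mul a b x y :
  ideal_power I a x -> ideal_power I b y -> ideal_power I (a + b) (x * y).
Proof.
move=> Ix Iy; elim: Ix => {a x} [r|a|a x x' _ IHx _ IHx'|a x x' Ix _ IHx'].
- exact: ideal_power_mull.
- by rewrite mul0r; apply: IdealPower0.
- by rewrite mulrDl; apply: IdealPowerD.
- by rewrite -mulrA addSn; apply: IdealPowerM.
Qed.

Lemma ideal_power_split a b r Q : ideal_power I (a + b) r -> Q 0 ->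
  (forall x y, Q x -> Q y -> Q (x + y)) ->
  (forall x y, ideal_power I a x -> ideal_power I b y -> Q (x * y)) -> Q r.
Proof.
elim: a r Q => [|a IH] r Q; rewrite ?addSn.
  by move=> Ir _ _ QM; rewrite -[r]mul1r; apply: QM => //; apply: IdealPowerAll.
move=> Ir Q0 QD QM; move nE: (a + b).+1 Ir => n Ir.
elim: Ir nE => {n r} // [n x y _ IHx _ IHy nE|n x y Ix Iy _ [nE]].
  by apply: QD; [apply: IHx|apply: IHy].
rewrite -nE in Iy; apply: (IH y (fun y => Q (x * y))) => //.
- by rewrite mulr0.
- by move=> u v Qu Qv; rewrite mulrDr; apply: QD.
by move=> u v Iu Iv; rewrite mulrA; apply: QM => //; apply: IdealPowerM.
Qed.

Lemma ideal_power_leq a b r : (a <= b)%N -> ideal_power I b r -> ideal_power I a r.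
Proof.
move=> /subnK <- Ir; apply: (ideal_power_split Ir) => [|x y|x y _].
- exact: IdealPower0.
- exact: IdealPowerD.
- exact: ideal_power_mull.
Qed.

Lemma ideal_power_power H m : (forall r, ideal_power I m r -> H r) ->
  forall k r, ideal_power I (k * m) r -> ideal_power H k r.
Proof.
move=> IH; elim=> [|k IHk] r; first by move=> _; apply: IdealPowerAll.
rewrite mulSn => Ir; apply: (ideal_power_split Ir) => [|x y|x y /IH Hx /IHk].
- exact: IdealPower0.
- exact: IdealPowerD.
- exact: IdealPowerM.
Qed.

End LeftIdeal.

(** Let 1 = e_1 + ... + e_t and e_j H e_j = 0.  Inserting 1 after every factor
    writes a product of elements of H as a sum of words in which the e_j
    separate elements of H; two equal e_j enclose an element of H and kill the
    word.  The set [D] records the e_j that the word [z] already contains, so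
    each further factor enlarges it. *)
Lemma ideal_power_idempotents_eq0 H t (e : 'I_t -> R) :
  (forall x r, H x -> H (x * r)) ->
  \sum_j e j = 1 -> (forall j x, H x -> e j * x * e j = 0) ->
  forall r, ideal_power H t.+1 r -> r = 0.
Proof.
move=> HR e1 eHe.
suff step k (D : {set 'I_t}) z : (forall j x, j \in D -> H x -> z * x * e j = 0) ->
    (#|~: D| < k)%N -> forall r, ideal_power H k r -> z * r = 0.
  move=> r Hr; rewrite -[r]mul1r; apply: (step t.+1 finset.set0) => //.
    by move=> j x; rewrite finset.in_set0.
  by rewrite ltnS -[t in leqRHS]card_ord max_card.
elim: k D z => // k IH D z zD Dk r.
move nE: k.+1 => n Hr; elim: Hr nE => {n r} // [n|n x y _ IHx _ IHy nE|n x y Hx Hy _ [nE]].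
- by rewrite mulr0.
- by rewrite mulrDr IHx // IHy // addr0.
rewrite -nE in Hy; rewrite mulrA -[z * x]mulr1 -e1 mulr_sumr mulr_suml big1 // => j _.
have [jD|jD] := boolP (j \in D); first by rewrite zD ?mul0r.
apply: (IH (j |: D)) Hy => [i u|].
  rewrite finset.in_setU1 => /orP[/eqP ->|iD] Hu.
    by rewrite -!mulrA [e j * _]mulrA eHe ?mulr0.
  by rewrite -[z * x * e j * u]mulrA -[z * x * (e j * u)]mulrA zD //; apply: HR.
have := Dk; rewrite (cardsD1 j) finset.in_setC jD add1n ltnS; apply: leq_trans.
rewrite ltnS subset_leq_card //; apply/fintype.subsetP => i.
by rewrite !finset.inE negb_or.
Qed.

End IdealPower.

(** * The grading of the Yoneda ring *)

Section Grading.
Variables (A : pzRingType) (M : lmodType A) (P : projres M).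
Notation E := (extring P).

Lemma homogD n (a b : ext P M n) : homog (a + b) = homog a + homog b.
Proof.
apply: extringP => k; rewrite ext_compD /= /hcomp; case: eqP => [e|_].
  exact: ext_castD.
by rewrite addr0.
Qed.

Lemma homog0 n : homog (0 : ext P M n) = 0.
Proof. by apply: (addrI (homog (0 : ext P M n))); rewrite -homogD !addr0. Qed.

Lemma homog_sum n (I : Type) (s : seq I) (F : I -> ext P M n) :
  homog (\sum_(i <- s) F i) = \sum_(i <- s) homog (F i).
Proof. exact: (big_morph _ (@homogD n) (homog0 n)). Qed.

Lemma homog_inj n (a : ext P M n) : homog a = 0 -> a = 0.
Proof. by move=> /(congr1 (fun x : E => ext_comp x n)); rewrite /= hcomp_id. Qed.

Lemma homog_degree n (a : ext P M n) : @extring_degree _ _ P n (homog a).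
Proof. by move=> k /eqP kn; apply: hcomp_neq; rewrite eq_sym. Qed.

Lemma extring_sum_homog (x : E) b : (forall k, (b <= k)%N -> ext_comp x k = 0) ->
  x = \sum_(i < b) homog (ext_comp x i).
Proof.
move=> xb; apply: extringP => k.
rewrite (big_morph (fun y : E => ext_comp y k) (@ext_compD _ _ P k) (ext_comp0 P k)).
have [bk|kb] := leqP b k.
  rewrite xb // big1 // => i _; apply: hcomp_neq.
  by rewrite ltn_eqF // (leq_trans (ltn_ord i)).
rewrite (bigD1 (Ordinal kb)) //= hcomp_id big1 ?addr0 // => i ik.
by apply: hcomp_neq; apply: contraNneq ik => ik; apply/eqP/val_inj.
Qed.

Lemma ext_compM (x y : E) n : ext_comp (x * y) n = extring_mul_comp x y n.
Proof. by []. Qed.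

Lemma homog_compM (x y : E) n : homog (ext_comp (x * y) n) =
  \sum_(i < n.+1) homog (ext_comp x i) * homog (ext_comp y (n - i)).
Proof.
rewrite ext_compM homog_sum; apply: eq_bigr => i _.
by rewrite homog_cast -homogM.
Qed.

Lemma extring_generated_bounded d : (forall n, (d < n)%N -> forall a : ext P M n, a = 0) ->
  generated_in_finite_degrees (@extring_degree _ _ P).
Proof.
move=> Pd; exists d => S _ SP x; rewrite (@extring_sum_homog x d.+1) => [|k /Pd //].
exact/(SP (fun i => homog (ext_comp x i)))/(fun i => homog_degree _).
Qed.

(** A two-sided ideal; for m = 1 it is the augmentation ideal. *)
Definition degree_ge m (x : E) : Prop := forall k, (k < m)%N -> ext_comp x k = 0.

Lemma degree_ge_mull m r x : degree_ge m x -> degree_ge m (r * x).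
Proof.
move=> xm k km; rewrite ext_compM; apply: big1 => i _.
by rewrite (xm (k - i)%N) ?yoneda0r ?ext_cast0 // (leq_ltn_trans (leq_subr _ _)).
Qed.

Lemma degree_ge_mulr m x r : degree_ge m x -> degree_ge m (x * r).
Proof.
move=> xm k km; rewrite ext_compM; apply: big1 => i _.
by rewrite (xm i) ?yoneda0l ?ext_cast0 // (leq_ltn_trans (leq_ord i)).
Qed.

Lemma ideal_power_degree_ge m x : ideal_power (degree_ge 1) m x -> degree_ge m x.
Proof.
elim=> {m x} [r k //|n k //|n x y _ IHx _ IHy k kn|n x y x0 _ IHy k kn].
  by rewrite ext_compD IHx // IHy // addr0.
rewrite ext_compM; apply: big1 => -[[|i] ik] _ /=.
  by rewrite x0 // yoneda0l ext_cast0.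
rewrite IHy ?yoneda0r ?ext_cast0 // ltn_subLR; last by rewrite -ltnS.
by rewrite addSn ltnS (leq_trans _ (leq_addl _ _)).
Qed.

Lemma ceil_le d n k : ((n + d) %/ d.+1 <= k)%N = (n <= k * d.+1)%N.
Proof. by rewrite -ltnS ltn_divLR // mulSn addnC addSn ltnS leq_add2l. Qed.

(** If E is generated in degrees at most d, then a homogeneous element of degree
    n lies in the ceil(n / (d + 1))-th power of the augmentation ideal: the
    elements all of whose components satisfy this form a subring, because the
    ceiling is subadditive, and it contains the generators.  Dividing by d + 1
    instead of d allows d = 0. *)
Lemma generated_ideal_power : generated_in_finite_degrees (@extring_degree _ _ P) ->
  exists d, forall n (a : ext P M n),
    ideal_power (degree_ge 1) ((n + d) %/ d.+1) (homog a).
Proof.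
move=> [d gen]; exists d => n a.
have mull := @degree_ge_mull 1.
pose S : {pred E} := fun x =>
  `[< forall n, ideal_power (degree_ge 1) ((n + d) %/ d.+1) (homog (ext_comp x n)) >].
suff /asboolP/(_ n) : homog a \in S by rewrite /= hcomp_id.
have low k (b : ext P M k) : (k <= d)%N ->
    ideal_power (degree_ge 1) ((k + d) %/ d.+1) (homog b).
  case: k b => [|k] b kd; first by rewrite add0n divn_small //; apply: IdealPowerAll.
  have /ideal_power_leq : ((k.+1 + d) %/ d.+1 <= 1)%N.
    by rewrite ceil_le mul1n leqW.
  apply=> //; rewrite -[homog b]mulr1; apply: IdealPowerM.
    by case=> // _; apply: hcomp_neq.
  exact: IdealPowerAll.
apply: gen.
  split.
  - apply/asboolP => k; rewrite -[1]/(homog (ext_one P)) /=.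
    by case: k => [|k]; [apply: low|rewrite hcomp_neq // homog0; apply: IdealPower0].
  - move=> x y /asboolP xS /asboolP yS; apply/asboolP => k.
    rewrite ext_compD homogD; apply: IdealPowerD => //.
    have -> : homog (ext_comp (- y) k) = - homog (ext_comp y k).
      apply/eqP; rewrite -addr_eq0 -homogD -ext_compD addNr; apply/eqP.
      exact: homog0.
    exact: ideal_power_opp.
  - move=> x y /asboolP xS /asboolP yS; apply/asboolP => k.
    rewrite homog_compM; apply: ideal_power_sum => i _.
    apply: (ideal_power_leq _ _ (ideal_power_mul _ (xS _) (yS _))) => //.
    by rewrite ceil_le mulnDl -{1}(subnKC (leq_ord i)) leq_add // -ceil_le.
move=> x xdeg; apply/asboolP => k.
rewrite (big_morph (fun y : E => ext_comp y k) (@ext_compD _ _ P k) (ext_comp0 P k)).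
rewrite homog_sum; apply: ideal_power_sum => i _.
have [ik|ik] := eqVneq k i; first by apply: low; rewrite ik leq_ord.
by rewrite xdeg ?homog0; [apply: IdealPower0|apply/eqP].
Qed.

(** In high degrees every element is a sum of products of t.+1 * m factors of
    positive degree; grouped by m, these are t.+1 factors of degree at least m,
    and such products vanish. *)
Lemma generated_idempotents_bounded m t (e : 'I_t -> E) :
  generated_in_finite_degrees (@extring_degree _ _ P) ->
  \sum_j e j = 1 -> (forall j x, degree_ge m x -> e j * x * e j = 0) ->
  exists n, forall a : ext P M n.+1, a = 0.
Proof.
move=> /generated_ideal_power[d gen] e1 eHe.
exists (t.+1 * m * d.+1)%N => a; apply: homog_inj.
apply: (ideal_power_idempotents_eq0 _ e1 eHe) => [x r|].
  exact: degree_ge_mulr.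
apply: (ideal_power_power (@ideal_power_degree_ge m)).
apply: (ideal_power_leq (@degree_ge_mull 1) _ (gen _ a)).
by rewrite leq_divRL // addSn ltnW // ltnS leq_addr.
Qed.

End Grading.

(** * Global dimension and the Yoneda ring *)

(** For e = [i] . [p] and y of degree n at least m, associativity gives
    e . y . e = [i] . ([p] . y . [i]) . [p], whose inner factor lies in
    Ext^n(S, S). *)
Lemma factor_sandwich_eq0 (A : pzRingType) (M S : lmodType A) (P : projres M)
    (Q : projres S) (p : hom M S) (i : hom S M) (m : nat) :
  (forall n, (m <= n)%N -> forall x : ext Q S n, x = 0) ->
  forall x : extring P, degree_ge m x ->
  homog (hom_class P (homcomp i p)) * x * homog (hom_class P (homcomp i p)) = 0.
Proof.
move=> SS x xm; have [b xb] := ext_finite x.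
rewrite (extring_sum_homog xb) mulr_sumr mulr_suml big1 // => -[n nb] _ /=.
have [nm|mn] := ltnP n m; first by rewrite xm // homog0 mulr0 mul0r.
move: (ext_comp x n) => y {x xm b xb nb}; set e := hom_class P _.
have eE : e = yoneda (hom_class Q i) (hom_class P p) by rewrite hom_classM.
have ey : yoneda e y = yoneda (hom_class Q i) (yoneda (hom_class P p) y).
  by rewrite eE -(yonedaA (erefl : (0 + (0 + n) = 0 + 0 + n)%N)) ext_cast_id.
have eyi : yoneda (yoneda e y) (hom_class Q i) = 0.
  rewrite ey -(yonedaA (erefl : (0 + (0 + n + 0) = 0 + (0 + n) + 0)%N)) ext_cast_id.
  rewrite [yoneda (yoneda _ y) _]SS ?yoneda_0r //.
  by rewrite addn0.
have -> : homog e * homog y * homog e = homog (yoneda (yoneda e y) e).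
  by rewrite -!homogM.
rewrite {2}eE.
have c : (0 + n + (0 + 0) = 0 + n + 0 + 0)%N by rewrite !addn0.
rewrite -(homog_cast c) yonedaA eyi yoneda_0l; exact: homog0.
Qed.

Theorem theorem1 (A : pzRingType) (hA : semiprimary A) :
  finite_gldim A <->
  generated_in_finite_degrees (@yoneda_degree A) /\
  exists m : nat, (0 < m)%N /\
    forall S : lmodType A, simple_module S ->
    forall n : nat, (m <= n)%N -> forall x : Ext n S S, x = 0%R.
Proof.
split=> [[d pd]|[gen [m [_ SS]]]].
  have ext0 (M N : lmodType A) n : (d < n)%N -> forall x : Ext n M N, x = 0.
    by move=> dn; have [P P0] := pd M; apply: projres_ext_eq0 (P0 n dn) N.
  split; first by apply: (@extring_generated_bounded _ _ _ d) => n dn a; apply: ext0.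
  by exists d.+1; split=> // S _ n dn; apply: ext0.
have [_ ssA] := hA; have [t [s sE]] := quoJ_sum_simple_factors ssA.
pose e j : yoneda_ring A :=
  homog (hom_class (free_res (quoJ A)) (homcomp (factor_inj (s j)) (factor_proj (s j)))).
have [||k TT] := @generated_idempotents_bounded _ _ _ m _ e gen.
- rewrite -homog_sum -[RHS]/(homog (ext_one _)); congr homog.
  rewrite -hom_class_sum; apply: hom_class1 => x.
  by rewrite hom_sumE [RHS]sE.
- move=> j x; apply: (factor_sandwich_eq0 (Q := free_res _)).
  exact: SS (factor_simple (s j)).
exists k => M.
have [P P0] := resolution_length_projres (ext_quoJ_eq0_resolution_length hA TT M).
by exists P.
Qed.
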